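(* Let $n>1$ be an integer and let $\omega,\alpha$ be nonzero real constants. Consider the nonlinear hyperbolic partial differential equations $$\text{(I)}\quad \frac{\partial u(\eta,t)}{\partial t}=\frac{1}{\sinh\eta}\frac{\partial}{\partial\eta}\left(\sinh\eta\,\frac{\partial u^{n}}{\partial\eta}\right)-u,\qquad\qquad \text{(II)}\quad \frac{\partial u}{\partial t}-\frac{i\omega}{\alpha}u=\frac{1}{\sinh\eta}\frac{\partial}{\partial\eta}\left(\sinh\eta\,\frac{\partial u^{n}}{\partial\eta}\right).$$ For any real number $\lambda\neq0$, given suitable initial conditions for (I) and (II), there exist locally the following solutions: for (I), $$u(\eta,t)=\sqrt[n-1]{\frac{1}{\lambda-ce^{(n-1)t}}}\cdot\sum_{j=0}^{+\infty}\frac{1}{j!}\frac{d^{j}u_\lambda}{dz^{j}}(a)\,(\delta'\cosh\eta-a)^{j},$$ and for (II), $$u(\eta,t)=\sqrt[n-1]{\frac{-\frac{i\omega}{\alpha}}{\lambda-ce^{-(n-1)\frac{i\omega}{\alpha}t}}}\cdot\sum_{j=0}^{+\infty}\frac{1}{j!}\frac{d^{j}u_\lambda}{dz^{j}}(a)\,(\delta'\cosh\eta-a)^{j}.$$ Here $c\neq0$ is a suitable real number (for the temporal part), and $\delta'>0$ and $a>0$ are appropriate real numbers such that the function $u_\lambda(z)$, $z=\delta'\cosh\eta$, exists and is analytic near the initial conditions and satisfies $$\frac{1}{(k+2)!}\frac{d^{k+2}u_\lambda(z)}{dz^{k+2}}=\mathcal{Q}_{k+2,n}\left(u_\lambda(z),\frac{du_\lambda(z)}{dz},\lambda,\delta'\right)\qquad\text{for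 all integers }k>0.$$
   Context: ''Locally'' means for $(\eta,t)$ in some product of nonempty open intervals with $\eta>0$; the $(n-1)$-th root denotes a differentiable choice of root in $t$, where the denominator is nonzero; $i$ denotes the imaginary unit and $u^n$ the $n$-th power of $u$. The function $u_\lambda(\delta'\cosh\eta)$ is an eigenfunction of $\Delta_H u^n=\frac{1}{\sinh\eta}\frac{\partial}{\partial\eta}\left(\sinh\eta\frac{\partial u^n}{\partial\eta}\right)$ with eigenvalue $\lambda$, i.e. $g(\eta)=u_\lambda(\delta'\cosh\eta)$ is not identically zero and $\Delta_H g^n=\lambda g$. The rational functions $\mathcal{Q}_{j,n}=\mathcal{Q}_{j,n}(X,Y,Z,W)\in\mathbb{R}(X,Y,Z,W)$ are defined recursively. For a sequence $(a_l)_{l\ge 0}$ with $a_0\ne 0$ define $b_j=b_j\big((a_l)_{l=0}^{j}\big)$ by $b_0=a_0^n$ and $b_j=\frac{1}{j a_0}\sum_{k=1}^{j}(k(n+1)-j)a_k b_{j-k}$ for $j>0$. Then $\mathcal{Q}_{0,n}=X$, $\mathcal{Q}_{1,n}=Y$, $\mathcal{Q}_{2,n}=-\frac{Z}{2W^{2}nX^{n-2}}-\frac{(n-1)Y^{2}}{2X}$, and, for $m>0$, $$\mathcal{Q}_{m+2,n}=-\frac{Z\,\mathcal{Q}_{m,n}}{W^{2}(m+1)(m+2)nX^{n-1}}+\frac{1}{W^{2}(m+2)nX^{n}}\left(\sum_{k=1}^{m}(k(n+1)-m)\mathcal{Q}_{k,n}\,b_{m-k}\big((\mathcal{Q}_{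l,n})_{l=0}^{m-k}\big)-W^{2}\sum_{k=1}^{m+1}(k(n+1)-m-2)\mathcal{Q}_{k,n}\,b_{m+2-k}\big((\mathcal{Q}_{l,n})_{l=0}^{m+2-k}\big)\right).$$
   Formalization: The identity with Q_{k+2,n} is required only at one point z0 of the disc of convergence around a (z0 = 0 in the existence proof, not of the form δ' cosh η), not at every z: no nonzero eigenfunction satisfies it for all z of an interval. *)

(* Defs.v *)
(* Stdlib reals with Coquelicot *)
From Stdlib Require Import Reals Lra Lia Arith.
From Coquelicot Require Import Coquelicot.

Open Scope R_scope.

(* Course-of-values recursion: [cov step j] is [step j q] where [q] agrees with
   [cov step] below [j]. *)
Fixpoint cov_table (step : nat -> (nat -> R) -> R) (j : nat) : nat -> R :=
  match j with
  | O => fun _ => step O (fun _ => 0)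
  | S i => fun l =>
      if (l <=? i)%nat then cov_table step i l
      else step (S i) (cov_table step i)
  end.

Definition cov (step : nat -> (nat -> R) -> R) (j : nat) : R :=
  cov_table step j j.

Definition b_step (n : nat) (a : nat -> R) (j : nat) (b : nat -> R) : R :=
  match j with
  | O => a O ^ n
  | S _ =>
      / (INR j * a O) *
      sum_n_m (fun k => (INR k * (INR n + 1) - INR j) * a k * b (j - k)%nat) 1 j
  end.

(* Coefficients of the n-th power of a formal power series [a], [a 0 <> 0]. *)
Definition b (n : nat) (a : nat -> R) : nat -> R := cov (b_step n a).

Definition Q_step (n : nat) (X Y Z W : R) (j : nat) (q : nat -> R) : R :=
  match j with
  | O => X
  | S O => Y
  | S (S O) =>
      - (Z / (2 * W ^ 2 * INR n * X ^ (n - 2)))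
      - (INR n - 1) * Y ^ 2 / (2 * X)
  | S (S m) =>
      - (Z * q m / (W ^ 2 * (INR m + 1) * (INR m + 2) * INR n * X ^ (n - 1)))
      + / (W ^ 2 * (INR m + 2) * INR n * X ^ n) *
        (sum_n_m (fun k => (INR k * (INR n + 1) - INR m)
                           * q k * b n q (m - k)) 1 m
         - W ^ 2 *
           sum_n_m (fun k => (INR k * (INR n + 1) - INR m - 2)
                             * q k * b n q (m + 2 - k)) 1 (m + 1))
  end.

(* The value of the rational function Q_{j,n} at the real point (X, Y, Z, W); it
   is meaningful for [X <> 0] and [W <> 0], its only possible poles for n > 1. *)
Definition Q (n j : nat) (X Y Z W : R) : R := cov (Q_step n X Y Z W) j.

Lemma cov_tableE step i l : (l <= i)%nat -> cov_table step i l = cov step l.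
Proof.
induction i as [|i IH]; intros Hl.
- now replace l with O by lia.
- destruct (Nat.eq_dec l (S i)) as [->|Hne]; [reflexivity|].
  cbn [cov_table]. rewrite (proj2 (Nat.leb_le l i)) by lia. apply IH; lia.
Qed.

Lemma covS step i : cov step (S i) = step (S i) (cov_table step i).
Proof.
unfold cov; cbn [cov_table]. now rewrite (proj2 (Nat.leb_gt (S i) i)) by lia.
Qed.

Lemma b_0 n a : b n a 0 = a O ^ n.
Proof. reflexivity. Qed.

Lemma b_pos n a j : (0 < j)%nat ->
  b n a j = / (INR j * a O) *
    sum_n_m (fun k => (INR k * (INR n + 1) - INR j) * a k * b n a (j - k)) 1 j.
Proof.
destruct j as [|i]; [lia|intros _].
unfold b at 1; rewrite covS; unfold b_step; apply f_equal.
apply sum_n_m_ext_loc; intros k Hk; apply f_equal; apply cov_tableE; lia.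
Qed.

Lemma b_ext n a a' j :
  (forall l, (l <= j)%nat -> a l = a' l) -> b n a j = b n a' j.
Proof.
induction j as [j IH] using lt_wf_ind; intros Ha.
destruct j as [|i]; [now rewrite !b_0, Ha by lia|].
rewrite !b_pos, (Ha O) by lia; apply f_equal.
apply sum_n_m_ext_loc; intros k Hk.
rewrite (Ha k), IH by (try lia; intros; apply Ha; lia); reflexivity.
Qed.

Lemma Q_0 n X Y Z W : Q n 0 X Y Z W = X.
Proof. reflexivity. Qed.

Lemma Q_1 n X Y Z W : Q n 1 X Y Z W = Y.
Proof. reflexivity. Qed.

Lemma Q_2 n X Y Z W :
  Q n 2 X Y Z W = - (Z / (2 * W ^ 2 * INR n * X ^ (n - 2)))
                  - (INR n - 1) * Y ^ 2 / (2 * X).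
Proof. reflexivity. Qed.

Lemma Q_rec n X Y Z W m (q := fun j => Q n j X Y Z W) : (0 < m)%nat ->
  q (m + 2)%nat =
  - (Z * q m / (W ^ 2 * (INR m + 1) * (INR m + 2) * INR n * X ^ (n - 1)))
  + / (W ^ 2 * (INR m + 2) * INR n * X ^ n) *
    (sum_n_m (fun k => (INR k * (INR n + 1) - INR m) * q k * b n q (m - k)) 1 m
     - W ^ 2 *
       sum_n_m (fun k => (INR k * (INR n + 1) - INR m - 2)
                         * q k * b n q (m + 2 - k)) 1 (m + 1)).
Proof.
destruct m as [|p]; [lia|intros _].
replace (q (S p + 2)%nat) with (q (S (S (S p)))) by (apply f_equal; lia).
unfold q at 1, Q; rewrite covS.
assert (Hq : forall l, (l <= S (S p))%nat ->
  cov_table (Q_step n X Y Z W) (S (S p)) l = q l)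
  by (intros l Hl; now apply cov_tableE).
generalize dependent (cov_table (Q_step n X Y Z W) (S (S p))); intros q' Hq'.
cbv beta iota delta [Q_step].
rewrite (Hq' (S p)) by lia.
apply f_equal; apply f_equal; f_equal; [|apply f_equal];
  apply sum_n_m_ext_loc; intros k Hk; rewrite (Hq' k) by lia; f_equal;
  apply b_ext; intros l Hl; apply Hq'; lia.
Qed.

(* [u] is the sum of its Taylor series at [a] on the open disc of radius [r],
   hence analytic at every point of it. *)
Definition analytic_near (u : R -> R) (a r : R) : Prop :=
  0 < r /\
  (forall k, ex_derive_n u k a) /\
  (forall z, Rabs (z - a) < r ->
     is_series (fun j => / INR (fact j) * Derive_n u j a * (z - a) ^ j) (u z)).

(* [l] is the value at [eta] of (1 / sinh) d/deta (sinh df/deta), all the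
   derivatives involved being required to exist. *)
Definition is_DeltaH {V : NormedModule R_AbsRing} (f : R -> V) (eta : R) (l : V)
  : Prop :=
  exists (df : R -> V) (d : V),
    locally eta (fun x => is_derive f x (df x)) /\
    is_derive (fun x => scal (sinh x) (df x)) eta d /\
    l = scal (/ sinh eta) d.

(* u(d cosh eta) is an eigenfunction, for the eigenvalue [lambda], of the
   operator g |-> Delta_H g^n, on the set of the eta > 0 that [d * cosh] sends
   into the domain |z - a| < r of [u]. *)
Definition eigenfunction (n : nat) (lambda d a r : R) (u : R -> R) : Prop :=
  (exists eta, 0 < eta /\ Rabs (d * cosh eta - a) < r /\ u (d * cosh eta) <> 0) /\
  (forall eta, 0 < eta -> Rabs (d * cosh eta - a) < r ->
     is_DeltaH (V := R_NormedModule) (fun x => u (d * cosh x) ^ n) eta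
       (lambda * u (d * cosh eta))).

(* [u] plays the role of u_lambda, [d] that of delta', and [z0] is the point at
   which the initial conditions u(z0), u'(z0) are given. The Taylor coefficients
   of [u] are required to be the Q_{k+2,n} at the point [z0], as u(z0) <> 0 is
   what makes their values meaningful. The recursion for Q is the one satisfied
   by the Taylor coefficients at z = 0 of the solutions of
   ((z^2 - d^2) (u^n)')' = lambda u; as this equation is not autonomous, one
   cannot ask for the identity at every z of an interval. *)
Definition admissible (n : nat) (lambda d a r z0 : R) (u : R -> R) : Prop :=
  0 < d /\ 0 < a /\ analytic_near u a r /\
  eigenfunction n lambda d a r u /\
  Rabs (z0 - a) < r /\ u z0 <> 0 /\
  (forall k, (0 < k)%nat ->
     / INR (fact (k + 2)) * Derive_n u (k + 2) z0
     = Q n (k + 2) (u z0) (Derive_n u 1 z0) lambda d).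

Definition taylor_term (u : R -> R) (d a eta : R) (j : nat) : R :=
  / INR (fact j) * Derive_n u j a * (d * cosh eta - a) ^ j.

Definition denom_I (n : nat) (lambda c t : R) : R :=
  lambda - c * exp ((INR n - 1) * t).

(* In a product of open intervals around (eta0, t0), the function of the
   statement is defined and solves (I), for a differentiable choice [T] of the
   (n-1)-th root whose value at [t0] is [tau]. *)
Definition local_solution_I
  (n : nat) (lambda c d a : R) (u : R -> R) (eta0 t0 tau : R) : Prop :=
  exists (eta1 eta2 t1 t2 : R) (T : R -> R),
    (0 <= eta1 < eta0 /\ eta0 < eta2) /\ t1 < t0 < t2 /\ T t0 = tau /\
    (forall t, t1 < t < t2 ->
       denom_I n lambda c t <> 0 /\
       T t ^ (n - 1) = / denom_I n lambda c t /\
       ex_derive T t) /\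
    (forall eta, eta1 < eta < eta2 -> ex_series (taylor_term u d a eta)) /\
    let U eta t := T t * Series (taylor_term u d a eta) in
    forall eta t, eta1 < eta < eta2 -> t1 < t < t2 ->
      exists Ut L : R,
        is_derive (fun s => U eta s) t Ut /\
        is_DeltaH (V := R_NormedModule) (fun x => U x t ^ n) eta L /\
        Ut = L - U eta t.

Definition Cexp (z : C) : C :=
  (exp (Re z) * cos (Im z), exp (Re z) * sin (Im z)).

(* i omega / alpha *)
Definition kappa (omega alpha : R) : C := (Ci * RtoC (omega / alpha))%C.

Definition denom_II (n : nat) (omega alpha lambda c t : R) : C :=
  (RtoC lambda
   - RtoC c * Cexp (- (RtoC (INR n - 1) * kappa omega alpha * RtoC t)))%C.

Definition local_solution_II
  (n : nat) (omega alpha lambda c d a : R) (u : R -> R) (eta0 t0 : R) (tau : C)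
  : Prop :=
  exists (eta1 eta2 t1 t2 : R) (T : R -> C),
    (0 <= eta1 < eta0 /\ eta0 < eta2) /\ t1 < t0 < t2 /\ T t0 = tau /\
    (forall t, t1 < t < t2 ->
       denom_II n omega alpha lambda c t <> RtoC 0 /\
       (T t ^ (n - 1))%C
       = (- kappa omega alpha / denom_II n omega alpha lambda c t)%C /\
       ex_derive (V := C_R_NormedModule) T t) /\
    (forall eta, eta1 < eta < eta2 -> ex_series (taylor_term u d a eta)) /\
    let U eta t := (T t * RtoC (Series (taylor_term u d a eta)))%C in
    forall eta t, eta1 < eta < eta2 -> t1 < t < t2 ->
      exists Ut L : C,
        is_derive (V := C_R_NormedModule) (fun s => U eta s) t Ut /\
        is_DeltaH (V := C_R_NormedModule) (fun x => (U x t ^ n)%C) eta L /\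
        (Ut - kappa omega alpha * U eta t)%C = L.

(* Main.v *)
Require Import Defs.
From Stdlib Require Import Reals Lra Lia Arith.
From Coquelicot Require Import Coquelicot.
Open Scope R_scope.

(** Under z = delta' cosh eta the eigenvalue equation becomes
    ((z^2 - delta'^2) (u^n)')' = lambda u, and the Q_{j,n} are the Taylor coefficients
    of its solutions at z = 0. A function u_lambda must therefore be analytic on a
    disc containing both 0 and points beyond the singular point z = delta'. Take
    delta' = a = 1. At z = 1 the equation has a regular singular point, and it has an
    analytic solution with prescribed value u(1) = K there; replacing u by u / K
    turns lambda into eps = lambda / K^(n-1), which is as small as desired when K is
    large. For small eps the solution is a small perturbation of a constant, and its
    coefficients in powers of z - 1 are at most (3/4)^j / (j+1)^2, because these weights
    are stable under convolution; the disc of radius 5/4 around 1 contains 0.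
    Separating variables leaves T' = lambda T^n - T, respectively
    T' = lambda T^n + kappa T, whose solutions are the (n-1)-th roots of 1 / denom,
    respectively - kappa / denom, chosen through a logarithm of denom(t) / denom(t0) near t0. *)

(** * Taylor coefficients and the recursion for Q *)

(* Turns an equation in one of the structures carried by [R] into one that [ring] and
   [field] recognize. *)
Ltac R_eq :=
  repeat match goal with
  | |- context [@plus ?G ?x ?y] => change (@plus G x y) with (Rplus x y)
  | |- context [@mult ?G ?x ?y] => change (@mult G x y) with (Rmult x y)
  | |- context [@scal ?K ?G ?x ?y] => change (@scal K G x y) with (Rmult x y)
  | |- context [@opp ?G ?x] => change (@opp G x) with (Ropp x)
  | |- context [@minus ?G ?x ?y] => change (@minus G x y) with (Rminus x y)
  | |- context [@zero ?G] => change (@zero G) with R0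
  | |- context [@one ?G] => change (@one G) with R1
  end;
  match goal with |- @eq _ ?x ?y => cut (@eq R x y); [exact (fun H => H)|] end.

(* [F k] is the k-th derivative of [F 0] divided by k!. *)
Definition taylor_family (D : R -> Prop) (F : nat -> R -> R) : Prop :=
  forall k x, D x -> is_derive (F k) x (INR (S k) * F (S k) x).

Definition family_mult (F G : nat -> R -> R) (k : nat) (x : R) : R :=
  sum_f_R0 (fun i => F i x * G (k - i)%nat x) k.

Definition family_derive (F : nat -> R -> R) (k : nat) (x : R) : R :=
  INR (S k) * F (S k) x.

Lemma sum_f_R0_minus_first (f : nat -> R) (k : nat) :
  sum_f_R0 f k - f O = sum_n_m f 1 k.
Proof.
assert (H : sum_f_R0 f k = f O + sum_n_m f 1 k)
  by (rewrite <- sum_n_Reals; apply (sum_Sn_m f 0 k); lia).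
rewrite H; ring.
Qed.

Lemma sum_f_R0_first (f : nat -> R) (k : nat) :
  sum_f_R0 f (S k) = f O + sum_f_R0 (fun i => f (S i)) k.
Proof. rewrite decomp_sum by lia; reflexivity. Qed.

Lemma sum_f_R0_only_first (f : nat -> R) (k : nat) :
  (forall i, (0 < i)%nat -> f i = 0) -> sum_f_R0 f k = f O.
Proof.
intros Hf; induction k as [|k IH]; [reflexivity|].
rewrite tech5, IH, (Hf (S k)) by lia; ring.
Qed.

Lemma is_derive_sum_f_R0 (f : nat -> R -> R) (df : nat -> R) (x : R) (k : nat) :
  (forall i, (i <= k)%nat -> is_derive (f i) x (df i)) ->
  is_derive (fun y => sum_f_R0 (fun i => f i y) k) x (sum_f_R0 df k).
Proof.
induction k as [|k IH]; intros Hf; [now apply Hf|].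
apply (is_derive_plus (fun y => sum_f_R0 (fun i => f i y) k) (f (S k))).
- apply IH; intros i Hi; apply Hf; lia.
- apply Hf; lia.
Qed.

(** The Leibniz rule: dividing by factorials removes the binomial coefficients, so that products
    become Cauchy products. *)
Lemma taylor_family_mult (D : R -> Prop) (F G : nat -> R -> R) :
  taylor_family D F -> taylor_family D G -> taylor_family D (family_mult F G).
Proof.
intros HF HG k x Hx.
unfold family_mult at 1.
evar_last.
- apply (is_derive_sum_f_R0 (fun i y => F i y * G (k - i)%nat y)).
  intros i Hi.
  apply (is_derive_mult (F i) (G (k - i)%nat) x _ _ (HF i x Hx)
           (HG _ x Hx) Rmult_comm).
- unfold family_mult.
  set (P i := F i x * G (S k - i)%nat x).
  (* In degree [S k] the factor splits as [S k] = i + ([S k] - i). The terms with i come from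
     differentiating F and those with [S k] - i from differentiating G; each sum has one vanishing
     end term. *)
  transitivity (sum_f_R0 (fun i => INR i * P i) (S k)
                + sum_f_R0 (fun i => INR (S k - i) * P i) (S k)).
  + rewrite (sum_f_R0_first (fun i => INR i * P i)), tech5.
    rewrite Nat.sub_diag; simpl (INR 0); rewrite !Rmult_0_l, Rplus_0_l, Rplus_0_r.
    rewrite <- plus_sum; apply sum_eq; intros i Hi; unfold P; R_eq.
    replace (S k - S i)%nat with (k - i)%nat by lia.
    replace (S k - i)%nat with (S (k - i)) by lia.
    ring.
  + rewrite <- plus_sum, scal_sum; apply sum_eq; intros i Hi.
    rewrite minus_INR by lia; unfold P; ring.
Qed.

Lemma taylor_family_derive (D : R -> Prop) (F : nat -> R -> R) :
  taylor_family D F -> taylor_family D (family_derive F).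
Proof.
intros HF k x Hx.
apply (is_derive_scal (F (S k)) x (INR (S k)) _ (HF (S k) x Hx)).
Qed.

Lemma taylor_family_scal (D : R -> Prop) (F : nat -> R -> R) (c : R) :
  taylor_family D F -> taylor_family D (fun k x => c * F k x).
Proof.
intros HF k x Hx; evar_last.
- apply (is_derive_scal (F k) x c _ (HF k x Hx)).
- R_eq; ring.
Qed.

(** Each member is fixed by the derivative of the one before. This turns a differential identity on
    an open set into identities between Taylor coefficients of every order. *)
Lemma taylor_family_unique (D : R -> Prop) (F G : nat -> R -> R) :
  open D -> taylor_family D F -> taylor_family D G ->
  (forall x, D x -> F O x = G O x) -> forall k x, D x -> F k x = G k x.
Proof.
intros HD HF HG H0 k; induction k as [|k IH]; [exact H0|]; intros x Hx.
apply (Rmult_eq_reg_l (INR (S k))); [|apply not_0_INR; lia].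
rewrite <- (is_derive_unique _ _ _ (HF k x Hx)).
rewrite <- (is_derive_unique _ _ _ (HG k x Hx)).
apply Derive_ext_loc.
apply (filter_imp D); auto.
Qed.

Definition family_sqr_sub (s : R) (k : nat) (x : R) : R :=
  match k with O => x ^ 2 - s | 1%nat => 2 * x | 2%nat => 1 | _ => 0 end.

Lemma taylor_family_sqr_sub (D : R -> Prop) (s : R) :
  taylor_family D (family_sqr_sub s).
Proof.
intros [|[|[|k]]] x _; unfold family_sqr_sub; simpl INR;
  auto_derive; trivial; ring.
Qed.

Lemma taylor_family_pow (D : R -> Prop) (F : nat -> R -> R) (n : nat) :
  taylor_family D F ->
  exists G, taylor_family D G /\ forall x, G O x = F O x ^ n.
Proof.
intros HF; induction n as [|n [G [HG HG0]]].
- exists (fun k _ => match k with O => 1 | _ => 0 end); split; [|reflexivity].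
  intros [|k] x _; auto_derive; trivial; ring.
- exists (family_mult F G); split; [now apply taylor_family_mult|].
  intros x; unfold family_mult; simpl; now rewrite HG0.
Qed.

(* Compare the Taylor coefficients of both sides of u (u^n)' = n u^n u'. *)
Lemma b_taylor_family (D : R -> Prop) (F G : nat -> R -> R) (n : nat) (x : R) :
  open D -> taylor_family D F -> taylor_family D G ->
  (forall y, D y -> G O y = F O y ^ n) -> D x -> F O x <> 0 ->
  forall j, b n (fun k => F k x) j = G j x.
Proof.
intros HD HF HG H0 Hx Hne.
assert (Hid : forall j, family_mult F (family_derive G) j x
                        = INR n * family_mult (family_derive F) G j x).
{ intros j; revert x Hx Hne.
  enough (H : forall x, D x -> family_mult F (family_derive G) j x
                 = INR n * family_mult (family_derive F) G j x) by auto.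
  revert j.
  apply (taylor_family_unique D (family_mult F (family_derive G))
           (fun j x => INR n * family_mult (family_derive F) G j x)); trivial.
  - apply taylor_family_mult; auto using taylor_family_derive.
  - apply taylor_family_scal.
    apply taylor_family_mult; auto using taylor_family_derive.
  - intros x Hx; unfold family_mult, family_derive; simpl sum_f_R0; simpl INR.
    assert (HG1 : G 1%nat x = INR n * F 1%nat x * F O x ^ pred n).
    { transitivity (Derive (G O) x).
      - rewrite (is_derive_unique _ _ _ (HG O x Hx)); simpl; ring.
      - rewrite (Derive_ext_loc (G O) (fun y => F O y ^ n)).
        + apply is_derive_unique; evar_last.
          * apply is_derive_pow, HF, Hx.
          * R_eq; simpl; ring.
        + apply (filter_imp D); auto. }
    rewrite HG1, H0 by trivial.
    destruct n as [|p]; simpl pow; [simpl; ring|ring]. }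
intros j; induction j as [j IH] using lt_wf_ind.
destruct j as [|j]; [now rewrite b_0, H0|].
rewrite b_pos by lia.
specialize (Hid j); unfold family_mult, family_derive in Hid.
set (A := sum_f_R0 (fun i => INR (S j - i) * (F i x * G (S j - i)%nat x)) (S j)).
set (B := sum_f_R0 (fun i => INR i * (F i x * G (S j - i)%nat x)) (S j)).
assert (HA : A = INR n * B).
{ unfold A, B; rewrite tech5, Nat.sub_diag; simpl (INR 0).
  rewrite sum_f_R0_first; simpl (INR 0).
  rewrite !Rmult_0_l, Rplus_0_l, Rplus_0_r.
  transitivity (sum_f_R0 (fun i =>
    F i x * (INR (S (j - i)) * G (S (j - i)) x)) j).
  - apply sum_eq; intros i Hi; replace (S j - i)%nat with (S (j - i)) by lia; ring.
  - rewrite Hid; f_equal.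
    apply sum_eq; intros i Hi; replace (S j - S i)%nat with (j - i)%nat by lia; ring. }
rewrite (sum_n_m_ext_loc _ (fun k =>
  (INR k * (INR n + 1) - INR (S j)) * (F k x * G (S j - k)%nat x))).
2:{ intros k Hk; rewrite IH by lia; apply Rmult_assoc. }
(* Since k(n+1) - (j+1) = n k - (j+1-k), the sum extended to k = 0 is n B - A = 0. What remains is
   minus its term at k = 0, namely (j+1) F_0 G_{j+1}. *)
rewrite <- sum_f_R0_minus_first, Nat.sub_0_r.
replace (sum_f_R0 _ _) with (INR n * B - A).
2:{ unfold A, B; rewrite scal_sum, <- minus_sum; apply sum_eq; intros i Hi.
    rewrite minus_INR by lia; ring. }
rewrite HA; simpl (INR 0); field.
split; [trivial|apply not_0_INR; lia].
Qed.

(** Comparing coefficients at 0 in ((z^2 - d^2) (u^n)')' = lambda u links G_m and G_{m+2}. These are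
    the numbers b of the coefficients of u, and solving for the newest coefficient inside b_{m+2}
    gives the recursion of [Q]. *)
Lemma Q_taylor_family (D : R -> Prop) (F G : nat -> R -> R) (n : nat)
  (lambda d : R) :
  (1 < n)%nat -> open D -> taylor_family D F -> taylor_family D G ->
  (forall y, D y -> G O y = F O y ^ n) -> 
  (forall y, D y -> is_derive (fun z => (z ^ 2 - d ^ 2) * G 1%nat z) y
                      (lambda * F O y)) ->
  D 0 -> F O 0 <> 0 -> d <> 0 ->
  forall j, F j 0 = Q n j (F O 0) (F 1%nat 0) lambda d.
Proof.
intros Hn HD HF HG H0 Hode Hx Hne Hd.
assert (HnR : INR n <> 0) by (apply not_0_INR; lia).
set (a := fun k => F k 0).
assert (Hb : forall j, b n a j = G j 0)
  by now apply (b_taylor_family D).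
assert (Hrec : forall m, INR m * (INR m + 1) * G m 0
  - d ^ 2 * (INR m + 1) * (INR m + 2) * G (m + 2)%nat 0 = lambda * a m).
{ set (q := family_sqr_sub (d ^ 2)).
  set (p := family_mult q (family_derive G)).
  assert (Hp : taylor_family D p).
  { apply taylor_family_mult; [apply taylor_family_sqr_sub|].
    now apply taylor_family_derive. }
  intros m.
  transitivity (family_derive p m 0).
  2:{ apply (taylor_family_unique D (family_derive p)
               (fun k x => lambda * F k x)); trivial.
      - now apply taylor_family_derive.
      - now apply taylor_family_scal.
      - intros y Hy; unfold family_derive.
        rewrite <- (is_derive_unique _ _ _ (Hp O y Hy)).
        rewrite <- (is_derive_unique _ _ _ (Hode y Hy)).
        apply Derive_ext; intros z.
        unfold p, family_mult, q, family_derive; simpl; ring. }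
  unfold family_derive, p, family_mult, q.
  destruct m as [|m].
  - simpl; unfold family_derive; simpl; ring.
  (* At 0 the coefficients of z^2 - d^2 are -d^2, 0, 1, 0, ..., so only the indices 0 and 2 of the
     Cauchy product survive. The vanishing linear coefficient is what singles out the point 0. *)
  - rewrite !sum_f_R0_first.
    rewrite sum_f_R0_only_first by (intros [|i] Hi; [lia|simpl; ring]).
    unfold family_derive.
    replace (S (S m) - 2)%nat with m by lia.
    replace (S (S m) - 1)%nat with (S m) by lia.
    replace (S m + 2)%nat with (S (S (S m))) by lia.
    simpl family_sqr_sub; rewrite Nat.sub_0_r, !S_INR; ring. }
change (forall j, a j = Q n j (a O) (a 1%nat) lambda d).
intros j; induction j as [j IH] using lt_wf_ind.
destruct j as [|[|[|m]]].
- now rewrite Q_0.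
- now rewrite Q_1.
- rewrite Q_2.
  assert (Hm := Hrec O); simpl in Hm; rewrite <- (Hb 2%nat) in Hm.
  assert (H1 : b n a 1 = INR n * a 1%nat * (a O ^ n / a O)).
  { rewrite b_pos, sum_n_n, Nat.sub_diag, b_0 by lia; simpl INR; field; trivial. }
  assert (H2 := b_pos n a 2 ltac:(lia)).
  rewrite sum_n_Sm, sum_n_n in H2 by lia.
  rewrite Nat.sub_diag, b_0 in H2; change (2 - 1)%nat with 1%nat in H2.
  rewrite H1 in H2; rewrite H2 in Hm.
  clear H1 H2; R_eq.
  assert (Hpow : a O ^ n = a O ^ 2 * a O ^ (n - 2))
    by (rewrite <- pow_add; f_equal; lia).
  rewrite Hpow in Hm.
  (* This makes the product lambda a_0 appear, which [Hm] expresses through a_1 and a_2. *)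
  replace lambda with (lambda * a O / a O) by (field; trivial).
  rewrite <- Hm; R_eq; simpl INR; field.
  repeat split; trivial; now apply pow_nonzero.
- set (k := S m).
  replace (S (S k)) with (k + 2)%nat in * by (unfold k; lia).
  assert (Hk : (0 < k)%nat) by (unfold k; lia).
  assert (HkR : 0 < INR k) by now apply lt_0_INR.
  rewrite Q_rec by trivial.
  rewrite <- (IH k) by lia.
  rewrite (sum_n_m_ext_loc _ (fun i =>
    (INR i * (INR n + 1) - INR k) * a i * b n a (k - i))).
  2:{ intros i Hi; rewrite <- IH by lia; f_equal.
      apply b_ext; intros l Hl; rewrite <- IH by lia; reflexivity. }
  rewrite (sum_n_m_ext_loc
    (fun i => (INR i * (INR n + 1) - INR k - 2) * _ * _) (fun i =>
    (INR i * (INR n + 1) - INR k - 2) * a i * b n a (k + 2 - i))).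
  2:{ intros i Hi; rewrite <- IH by lia; f_equal.
      apply b_ext; intros l Hl; rewrite <- IH by lia; reflexivity. }
  assert (Hm := Hrec k); rewrite <- !Hb in Hm.
  assert (H1 := b_pos n a k Hk).
  assert (H2 := b_pos n a (k + 2) ltac:(lia)).
  (* The last term of the sum for b_{k+2} is the only one that contains a_{k+2}, with factor (k+2) n
     a_0^n; the others form the second sum in [Q_rec]. *)
  assert (Hlast : forall f : nat -> R,
    sum_n_m f 1 (k + 2) = plus (sum_n_m f 1 (k + 1)) (f (k + 2)%nat)).
  { intros f; replace (k + 2)%nat with (S (k + 1)) by lia.
    apply sum_n_Sm; lia. }
  rewrite Hlast in H2.
  rewrite Nat.sub_diag, b_0 in H2.
  rewrite (sum_n_m_ext_loc _ (fun i =>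
    (INR i * (INR n + 1) - INR k - 2) * a i * b n a (k + 2 - i)) 1 (k + 1)) in H2.
  2:{ intros i Hi; rewrite plus_INR; simpl (INR 2); f_equal; f_equal; ring. }
  revert H1 H2.
  set (S1 := sum_n_m _ 1 k); set (S2 := sum_n_m _ 1 (k + 1)).
  fold (a k) (a (k + 2)%nat) in *.
  rewrite plus_INR; simpl (INR 2); intros H1 H2.
  assert (Hpow : a O ^ n = a O * a O ^ (n - 1))
    by (rewrite tech_pow_Rmult; f_equal; lia).
  rewrite Hpow in *; rewrite <- Hm, H2, H1; R_eq; field.
  repeat split; trivial; try lra; now apply pow_nonzero.
Qed.

(** * A power series solution at the singular point *)

(* Coefficients of w in powers of x = z - 1, where
   ((z^2 - 1) w')' = eps u and [e] are the coefficients of u. *)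
Fixpoint w_coef (eps : R) (e : nat -> R) (j : nat) : R :=
  match j with
  | O => 1
  | S i => (eps * e i - INR i * INR (S i) * w_coef eps e i)
           / (2 * INR (S i) ^ 2)
  end.

Lemma w_coef_ext (eps : R) (e e' : nat -> R) (j : nat) :
  (forall i, (i < j)%nat -> e i = e' i) -> w_coef eps e j = w_coef eps e' j.
Proof.
induction j as [|j IH]; intros He; [reflexivity|].
cbn [w_coef]; rewrite IH, He by (try lia; intros; apply He; lia); reflexivity.
Qed.

(* Coefficients of u = w^(1/n), obtained from u w' = n w u'. *)
Definition u_step (n : nat) (eps : R) (j : nat) (e : nat -> R) : R :=
  match j with
  | O => 1
  | S _ =>
      / (INR n * INR j) *
      sum_n_m (fun k => (INR k * (INR n + 1) - INR n * INR j)
                        * w_coef eps e k * e (j - k)%nat) 1 j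
  end.

Definition u_coef (n : nat) (eps : R) : nat -> R := cov (u_step n eps).

(** The mutual recursion of u and w is well founded: w_k depends on the coefficients of u below k
    only, and k >= 1 keeps j - k below j. *)
Lemma u_coef_pos (n : nat) (eps : R) (j : nat) : (0 < j)%nat ->
  u_coef n eps j = / (INR n * INR j) *
    sum_n_m (fun k => (INR k * (INR n + 1) - INR n * INR j)
      * w_coef eps (u_coef n eps) k * u_coef n eps (j - k)%nat) 1 j.
Proof.
destruct j as [|i]; [lia|intros _].
unfold u_coef at 1; rewrite covS; unfold u_step at 1; apply f_equal.
apply sum_n_m_ext_loc; intros k Hk; rewrite cov_tableE by lia; f_equal; f_equal.
apply w_coef_ext; intros l Hl; apply cov_tableE; lia.
Qed.

(** * Convolution-stable weights and bounds on the coefficients *)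

Definition inv_sq (k : nat) : R := / INR (S k) ^ 2.

Lemma inv_sq_pos (k : nat) : 0 < inv_sq k.
Proof. apply Rinv_0_lt_compat, pow_lt, lt_0_INR; lia. Qed.

(** Telescoping with 1/(x+1)^2 <= 1/x - 1/(x+1). *)
Lemma sum_inv_sq_le (k : nat) : sum_f_R0 inv_sq k <= 2 - / INR (S k).
Proof.
induction k as [|k IH]; [unfold inv_sq; simpl; lra|].
rewrite tech5; apply Rle_trans with (1 := Rplus_le_compat_r _ _ _ IH).
unfold inv_sq; rewrite (S_INR (S k)).
assert (0 < INR (S k)) by (apply lt_0_INR; lia).
set (x := INR (S k)) in *.
enough (/ (x + 1) ^ 2 <= / x - / (x + 1)) by lra.
replace (/ x - / (x + 1)) with (/ (x * (x + 1))) by (field; lra).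
apply Rinv_le_contravar; nra.
Qed.

(* 1/(x y) = (1/x + 1/y)/(x + y) splits each term. *)
Lemma conv_inv_sq_le (j : nat) :
  sum_f_R0 (fun k => inv_sq k * inv_sq (j - k)) j <= 8 * inv_sq j.
Proof.
apply Rle_trans with
  (sum_f_R0 (fun k => (inv_sq k + inv_sq (j - k)) * (2 * inv_sq j)) j).
- apply sum_Rle; intros k Hk; unfold inv_sq.
  assert (Hj : INR (S j) = INR (S k) + INR (S (j - k)) - 1)
    by (rewrite !S_INR, minus_INR by lia; ring).
  assert (Hx : 1 <= INR (S k)) by (apply (le_INR 1); lia).
  assert (Hy : 1 <= INR (S (j - k))) by (apply (le_INR 1); lia).
  rewrite Hj; set (x := INR (S k)) in *; set (y := INR (S (j - k))) in *.
  (* After factoring out 1/(x^2 y^2), the claim for one term is (x+y-1)^2 <= 2 (x^2 + y^2). *)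
  replace ((/ x ^ 2 + / y ^ 2) * (2 * / (x + y - 1) ^ 2))
    with (/ x ^ 2 * / y ^ 2 * (2 * (x ^ 2 + y ^ 2) / (x + y - 1) ^ 2))
    by (field; lra).
  rewrite <- (Rmult_1_r (_ * _)) at 1.
  apply Rmult_le_compat_l.
  + rewrite <- Rinv_mult; apply Rlt_le, Rinv_0_lt_compat, Rmult_lt_0_compat; nra.
  + apply Rmult_le_reg_r with ((x + y - 1) ^ 2); [nra|].
    unfold Rdiv; rewrite Rmult_assoc, Rinv_l by (apply pow_nonzero; lra).
    assert ((x + y - 1) ^ 2 <= (x + y) ^ 2) by (apply pow_incr; lra).
    assert (H2 := pow2_ge_0 (x - y)); lra.
- rewrite <- scal_sum, plus_sum, (sum_f_R0_skip inv_sq j).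
  assert (H := sum_inv_sq_le j); assert (H' := inv_sq_pos j).
  assert (0 < / INR (S j)) by (apply Rinv_0_lt_compat, lt_0_INR; lia).
  nra.
Qed.

(** The ratio 3/4 exceeds the asymptotic factor 1/2 in the recursion of [w_coef], and still gives
    convergence up to 4/3, beyond the radius 5/4 of the disc in use. *)
Definition weight (k : nat) : R := (3 / 4) ^ k * inv_sq k.

Lemma weight_pos (k : nat) : 0 < weight k.
Proof. apply Rmult_lt_0_compat; [apply pow_lt; lra|apply inv_sq_pos]. Qed.

(** The recursion multiplies w_j by a factor of modulus less than 1/2 while the weights shrink by
    about 3/4; the margin absorbs the term in [eps]. *)
Lemma w_coef_bound_step (eps : R) (e : nat -> R) (j : nat) :
  Rabs eps <= 1 / 32 -> Rabs (e j) <= weight j ->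
  ((0 < j)%nat -> Rabs (w_coef eps e j) <= weight j / 8) ->
  Rabs (w_coef eps e (S j)) <= weight (S j) / 8.
Proof.
intros Heps He Hf; cbn [w_coef].
(* The coefficient w_0 = 1 violates the bound, but at j = 0 it is multiplied by 0. *)
assert (Hf' : INR j * Rabs (w_coef eps e j) <= INR j * (weight j / 8)).
{ destruct j as [|j]; [simpl; lra|].
  apply Rmult_le_compat_l; [apply pos_INR|apply Hf; lia]. }
assert (Hx : 1 <= INR (S j)) by (apply (le_INR 1); lia).
unfold Rdiv at 1; rewrite Rabs_mult, Rabs_inv, (Rabs_pos_eq (2 * _)) by nra.
apply Rmult_le_reg_r with (2 * INR (S j) ^ 2); [nra|].
rewrite Rmult_assoc, Rinv_l, Rmult_1_r by (apply Rgt_not_eq; nra).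
apply Rle_trans with (1 := Rabs_triang _ _).
rewrite Rabs_Ropp, !Rabs_mult, (Rabs_pos_eq (INR j)), (Rabs_pos_eq (INR (S j)))
  by apply pos_INR.
assert (Hw := weight_pos j).
apply Rle_trans with (weight j * (1 / 32 + INR j * INR (S j) / 8)).
{ assert (Rabs eps * Rabs (e j) <= 1 / 32 * weight j)
    by (apply Rmult_le_compat; trivial; apply Rabs_pos).
  assert (INR (S j) * (INR j * Rabs (w_coef eps e j))
          <= INR (S j) * (INR j * (weight j / 8)))
    by (apply Rmult_le_compat_l; lra).
  lra. }
unfold weight, inv_sq; rewrite (S_INR (S j)).
replace (INR j) with (INR (S j) - 1) by (rewrite S_INR; ring).
set (x := INR (S j)) in *.
simpl pow; fold ((3/4)^j).
replace ((3 / 4) ^ j * / (x * (x * 1)) * (1 / 32 + (x - 1) * x / 8))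
  with ((3/4)^j * ((1 / 32 + (x - 1) * x / 8) / x ^ 2)) by (field; lra).
replace (3 / 4 * (3 / 4) ^ j * / ((x + 1) * ((x + 1) * 1)) / 8 * (2 * (x * (x * 1))))
  with ((3/4)^j * (3 / 16 * x ^ 2 / (x + 1) ^ 2)) by (field; lra).
apply Rmult_le_compat_l; [apply pow_le; lra|].
apply Rmult_le_reg_r with (x ^ 2 * (x + 1) ^ 2); [nra|].
replace ((1 / 32 + (x - 1) * x / 8) / x ^ 2 * (x ^ 2 * (x + 1) ^ 2))
  with ((1 / 32 + (x - 1) * x / 8) * (x + 1) ^ 2) by (field; lra).
replace (3 / 16 * x ^ 2 / (x + 1) ^ 2 * (x ^ 2 * (x + 1) ^ 2))
  with (3 / 16 * x ^ 2 * x ^ 2) by (field; lra).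
(* Sixteen times the difference of the two sides is twice this product plus x - 1/2, and the
   quadratic factor is (x-1)^2/2 + 1/4. *)
assert (0 <= x ^ 2 * (1/2 * x ^ 2 - x + 3/4)) by (apply Rmult_le_pos; nra).
nra.
Qed.

(** Joint induction: w_j is bounded from the data at j - 1, then u_j by the convolution estimate.
    The 1/8 in the bound on w offsets the constant 8 of [conv_inv_sq_le]. *)
Lemma coef_bound (n : nat) (eps : R) (j : nat) :
  (0 < n)%nat -> Rabs eps <= 1 / 32 ->
  Rabs (u_coef n eps j) <= weight j /\
  ((0 < j)%nat -> Rabs (w_coef eps (u_coef n eps) j) <= weight j / 8).
Proof.
intros Hn Heps; induction j as [j IH] using lt_wf_ind.
destruct j as [|i].
{ split; [|lia]; unfold u_coef, cov, weight, inv_sq; simpl.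
  rewrite Rabs_R1; lra. }
assert (Hf : forall k, (1 <= k <= S i)%nat ->
  Rabs (w_coef eps (u_coef n eps) k) <= weight k / 8).
{ intros [|k] Hk; [lia|].
  apply w_coef_bound_step; trivial; apply IH; lia. }
split; [|intros _; apply Hf; lia].
rewrite u_coef_pos by lia; set (j := S i) in *.
assert (Hj : 1 <= INR j) by (apply (le_INR 1); lia).
assert (HnR : 1 <= INR n) by (apply (le_INR 1); lia).
rewrite Rabs_mult, Rabs_inv, (Rabs_pos_eq (_ * _)) by nra.
apply Rmult_le_reg_l with (INR n * INR j); [nra|].
rewrite <- Rmult_assoc, Rinv_r, Rmult_1_l by (apply Rgt_not_eq; nra).
rewrite <- sum_f_R0_minus_first.
rewrite decomp_sum by (unfold j; lia).
match goal with |- Rabs (?x + ?y - ?x) <= _ =>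
  replace (x + y - x) with y by ring end.
apply Rle_trans with (1 := Rsum_abs _ (pred j)).
apply Rle_trans with (sum_f_R0
  (fun k => inv_sq (S k) * inv_sq (j - S k)
            * (INR n * INR j * ((3 / 4) ^ j / 8))) (pred j)).
- apply sum_Rle; intros k Hk.
  set (l := S k).
  assert (Hl : (1 <= l <= j)%nat) by (unfold l, j; lia).
  destruct (IH (j - l)%nat ltac:(lia)) as [IHu _].
  assert (IHw := Hf l Hl).
  rewrite !Rabs_mult.
  apply Rle_trans with (INR n * INR j * (weight l / 8) * weight (j - l)).
  + apply Rmult_le_compat; trivial; try apply Rmult_le_pos; try apply Rabs_pos.
    apply Rmult_le_compat; trivial; try apply Rabs_pos.
    (* For 1 <= l <= j the factor l(n+1) - n j has modulus at most n j, which the prefactor 1/(n j)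
       cancels. *)
    assert (1 <= INR l <= INR j) by (split; [apply (le_INR 1)|apply le_INR]; lia).
    apply Rabs_le; nra.
  + unfold weight.
    replace ((3 / 4) ^ j) with ((3 / 4) ^ l * (3 / 4) ^ (j - l))
      by (rewrite <- pow_add; f_equal; lia).
    fold l; lra.
- rewrite <- scal_sum.
  assert (H := conv_inv_sq_le j).
  rewrite decomp_sum in H by (unfold j; lia).
  assert (H1 := inv_sq_pos 0); assert (H2 := inv_sq_pos (j - 0)).
  assert (H3 := pow_lt (3 / 4) j ltac:(lra)).
  unfold weight.
  match type of H with _ + ?S <= _ => assert (H4 : S <= 8 * inv_sq j) by nra end.
  apply Rle_trans with (INR n * INR j * ((3 / 4) ^ j / 8) * (8 * inv_sq j)).
  + apply Rmult_le_compat_l; [|exact H4].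
    apply Rmult_le_pos; [nra|lra].
  + apply Req_le; field.
Qed.

(** Because k(n+1) - n(j+1) = k - n(j+1-k), the recursion of [u_coef] says exactly that the
    coefficients of w' u and of n w u' agree. *)
Lemma u_coef_mult (n : nat) (eps : R) (e := u_coef n eps) (f := w_coef eps e)
  (j : nat) : (0 < n)%nat ->
  INR n * PS_mult f (PS_derive e) j = PS_mult (PS_derive f) e j.
Proof.
intros Hn; unfold PS_mult, PS_derive.
assert (Hu := u_coef_pos n eps (S j) ltac:(lia)).
fold e in Hu; fold f in Hu; rewrite <- sum_f_R0_minus_first in Hu.
assert (HJ : 0 < INR (S j)) by (apply lt_0_INR; lia).
assert (HnR : 0 < INR n) by now apply lt_0_INR.
assert (H : sum_f_R0 (fun k => (INR k * (INR n + 1) - INR n * INR (S j))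
                    * f k * e (S j - k)%nat) (S j) = 0).
{ rewrite Nat.sub_0_r in Hu; change (f O) with 1 in Hu; simpl (INR 0) in Hu.
  match type of Hu with e (S j) = / _ * (?s - _) =>
    assert (Hs : s = INR n * INR (S j) * (/ (INR n * INR (S j))
     * (s - (0 * (INR n + 1) - INR n * INR (S j)) * 1 * e (S j)) - e (S j)))
    by (field; lra) end.
  rewrite Hs, <- Hu; ring. }
transitivity (INR n * sum_f_R0 (fun k => INR (S j - k) * (f k * e (S j - k)%nat)) (S j)).
{ rewrite tech5, Nat.sub_diag; simpl (INR 0); rewrite Rmult_0_l, Rplus_0_r.
  f_equal; apply sum_eq; intros k Hk.
  replace (S j - k)%nat with (S (j - k)) by lia; ring. }
transitivity (sum_f_R0 (fun k => INR k * (f k * e (S j - k)%nat)) (S j)).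
2:{ rewrite sum_f_R0_first; simpl (INR 0); rewrite Rmult_0_l, Rplus_0_l.
    apply sum_eq; intros k Hk; simpl Nat.sub; ring. }
apply Rminus_diag_uniq; rewrite scal_sum, <- minus_sum.
rewrite <- (Ropp_involutive (sum_f_R0 _ _)), <- Ropp_0; f_equal.
rewrite <- H, <- (Rmult_1_l (sum_f_R0 _ _)), Ropp_mult_distr_l, scal_sum.
apply sum_eq; intros k Hk; rewrite minus_INR by lia; ring.
Qed.

(** * Sums of the two series and the differential equation *)

Lemma CV_radius_weight (a : nat -> R) (x : R) :
  (forall k, Rabs (a k) <= weight k) -> Rabs x < 4 / 3 ->
  Rbar_lt (Rabs x) (CV_radius a).
Proof.
intros Ha Hx; apply Rbar_lt_le_trans with (4 / 3); [exact Hx|].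
apply (proj1 (CV_radius_bounded a)); exists 1; intros k.
rewrite Rabs_mult, (Rabs_pos_eq (_ ^ _)) by (apply pow_le; lra).
apply Rle_trans with (weight k * (4 / 3) ^ k).
- apply Rmult_le_compat_r; [apply pow_le; lra|apply Ha].
- unfold weight.
  replace ((3 / 4) ^ k * inv_sq k * (4 / 3) ^ k)
    with ((3 / 4 * (4 / 3)) ^ k * inv_sq k) by (rewrite Rpow_mult_distr; ring).
  replace (3 / 4 * (4 / 3)) with 1 by field.
  rewrite pow1, Rmult_1_l; unfold inv_sq.
  rewrite <- Rinv_1; apply Rinv_le_contravar; [lra|].
  apply pow_R1_Rle, (le_INR 1); lia.
Qed.

(** For k >= 1 the terms are dominated by a geometric series of ratio (3/4)(5/4) = 15/16 and first
    term (1/4)/8 = 1/32. Its sum is 1/2, so the constant term 1 prevails. *)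
Lemma PSeries_pos (a : nat -> R) (x : R) :
  a O = 1 -> (forall k, (0 < k)%nat -> Rabs (a k) <= weight k / 8) ->
  Rabs x <= 5 / 4 -> 0 < PSeries a x.
Proof.
intros H0 Ha Hx; unfold PSeries.
assert (Hb : forall k, norm (a (S k) * x ^ S k) <= 1 / 32 * (15 / 16) ^ k).
{ intros k; change (Rabs (a (S k) * x ^ S k) <= 1 / 32 * (15 / 16) ^ k).
  rewrite Rabs_mult, <- RPow_abs.
  apply Rle_trans with (weight (S k) / 8 * (5 / 4) ^ S k).
  - apply Rmult_le_compat; try apply Rabs_pos; try apply pow_le, Rabs_pos.
    + apply Ha; lia.
    + apply pow_incr; split; [apply Rabs_pos|exact Hx].
  - unfold weight.
    replace ((3 / 4) ^ S k * inv_sq (S k) / 8 * (5 / 4) ^ S k)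
      with ((3 / 4 * (5 / 4)) ^ S k * (inv_sq (S k) / 8))
      by (rewrite Rpow_mult_distr; field).
    replace (3 / 4 * (5 / 4)) with (15 / 16) by field.
    assert (inv_sq (S k) <= 1 / 4).
    { unfold inv_sq; replace (1 / 4) with (/ 2 ^ 2) by field.
      apply Rinv_le_contravar; [lra|].
      apply pow_incr; split; [lra|apply (le_INR 2); lia]. }
    assert (0 < (15 / 16) ^ k) by (apply pow_lt; lra).
    simpl pow; nra. }
assert (Hg : is_series (fun k => 1 / 32 * (15 / 16) ^ k) (1 / 32 * / (1 - 15 / 16))).
{ apply (is_series_scal (V := R_NormedModule) (1 / 32)), is_series_geom.
  rewrite Rabs_pos_eq; lra. }
assert (Hc : ex_series (fun k => Rabs (a (S k) * x ^ S k))).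
{ apply (ex_series_le (V := R_CompleteNormedModule) _ (fun k => 1 / 32 * (15 / 16) ^ k)).
  - intros k; change (Rabs (Rabs (a (S k) * x ^ S k)) <= 1 / 32 * (15 / 16) ^ k).
    rewrite Rabs_Rabsolu; apply Hb.
  - eexists; exact Hg. }
rewrite Series_incr_1, H0.
2:{ apply ex_series_incr_1, ex_series_Rabs, Hc. }
assert (H := Series_Rabs _ Hc).
assert (H' : Series (fun k => Rabs (a (S k) * x ^ S k)) <= 1 / 2).
{ replace (1 / 2) with (Series (fun k => 1 / 32 * (15 / 16) ^ k))
    by (rewrite (is_series_unique _ _ Hg); field).
  apply Series_le; [|eexists; exact Hg].
  intros k; split; [apply Rabs_pos|apply Hb]. }
apply Rabs_le_between in H.
rewrite pow_O; lra.
Qed.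

Lemma is_derive_zero_constant {V : NormedModule R_AbsRing} (f : R -> V) (a b : R) :
  (forall t, a < t < b -> is_derive f t zero) ->
  forall x y, a < x < b -> a < y < b -> f x = f y.
Proof.
intros Hf x y Hx Hy.
destruct (Rtotal_order x y) as [H|[->|H]]; [|reflexivity|symmetry];
  apply eq_is_derive; trivial; intros t Ht; apply Hf; lra.
Qed.

(* n F E' = F' E gives (E^n / F)' = 0, for the sums E and F of the two series. *)
Lemma PSeries_w_coef (n : nat) (eps : R) (e := u_coef n eps) (f := w_coef eps e)
  (x : R) : (0 < n)%nat -> Rabs eps <= 1 / 32 -> Rabs x < 5 / 4 ->
  PSeries e x ^ n = PSeries f x.
Proof.
intros Hn Heps Hx.
assert (He : forall y, Rabs y < 5 / 4 -> Rbar_lt (Rabs y) (CV_radius e)).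
{ intros y Hy; apply CV_radius_weight; [|lra]; intros k; now apply coef_bound. }
assert (Hfw : forall k, (0 < k)%nat -> Rabs (f k) <= weight k / 8).
{ intros k Hk; now apply coef_bound. }
assert (Hf : forall y, Rabs y < 5 / 4 -> Rbar_lt (Rabs y) (CV_radius f)).
{ intros y Hy; apply CV_radius_weight; [|lra].
  intros [|k].
  - change (f O) with 1; rewrite Rabs_R1; unfold weight, inv_sq; simpl; lra.
  - assert (H := Hfw (S k) ltac:(lia)); assert (H' := weight_pos (S k)); lra. }
assert (Hpos : forall y, Rabs y < 5 / 4 -> 0 < PSeries f y)
  by (intros y Hy; apply PSeries_pos; trivial; lra).
assert (Hid : forall y, Rabs y < 5 / 4 ->
  INR n * (PSeries f y * PSeries (PS_derive e) y)
  = PSeries (PS_derive f) y * PSeries e y).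
{ intros y Hy.
  rewrite <- !PSeries_mult, <- PSeries_scal by (rewrite ?CV_radius_derive; auto).
  apply PSeries_ext; intros j; now apply u_coef_mult. }
assert (Hq : PSeries e x ^ n / PSeries f x = PSeries e 0 ^ n / PSeries f 0).
{ apply (is_derive_zero_constant (V := R_NormedModule)
    (fun y => PSeries e y ^ n / PSeries f y) (- (5 / 4)) (5 / 4)).
  - intros y Hy; assert (Hy' : Rabs y < 5 / 4) by now apply Rabs_def1.
    assert (Hp := Hpos y Hy').
    evar_last.
    + apply is_derive_div; [apply is_derive_pow| |lra];
        apply is_derive_PSeries; auto.
    + R_eq; specialize (Hid y Hy').
      destruct n as [|p]; [lia|]; simpl pred.
      replace (INR (S p) * PSeries (PS_derive e) y * PSeries e y ^ p * PSeries f y)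
        with (PSeries e y ^ p * (INR (S p) * (PSeries f y * PSeries (PS_derive e) y)))
        by ring.
      rewrite Hid; simpl pow; field; lra.
  - now apply Rabs_def2 in Hx.
  - lra. }
rewrite !PSeries_0 in Hq; change (e O) with 1 in Hq; change (f O) with 1 in Hq.
rewrite pow1 in Hq; assert (Hp := Hpos x Hx).
apply (Rmult_eq_reg_r (/ PSeries f x)); [|apply Rinv_neq_0_compat; lra].
rewrite Rinv_r by lra; rewrite <- Rdiv_1_r, <- Hq; reflexivity.
Qed.

(** With x = z - 1 the factor z^2 - 1 becomes x^2 + 2x, and the equation holds power by power by the
    recursion that defines [w_coef]. *)
Lemma w_coef_ode (eps : R) (e : nat -> R) (f := w_coef eps e) (x : R) :
  Rbar_lt (Rabs x) (CV_radius f) ->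
  is_derive (fun y => (y ^ 2 + 2 * y) * PSeries (PS_derive f) y) x
    (eps * PSeries e x).
Proof.
intros Hx.
set (g := PS_derive f); set (h := PS_derive g).
assert (Hg : Rbar_lt (Rabs x) (CV_radius g)) by now unfold g; rewrite CV_radius_derive.
assert (Hh : Rbar_lt (Rabs x) (CV_radius h)) by now unfold h; rewrite CV_radius_derive.
assert (Eg := CV_radius_inside _ _ Hg); assert (Eh := CV_radius_inside _ _ Hh).
evar_last.
- apply (is_derive_mult (fun y => y ^ 2 + 2 * y) (PSeries g) x (2 * x + 2)).
  + auto_derive; trivial; ring.
  + now apply is_derive_PSeries.
  + exact Rmult_comm.
- R_eq; fold h.
  transitivity (PSeries (PS_plus (PS_plus (PS_scal 2 (PS_incr_1 g)) (PS_scal 2 g))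
    (PS_plus (PS_incr_1 (PS_incr_1 h)) (PS_scal 2 (PS_incr_1 h)))) x).
  + rewrite !PSeries_plus, !PSeries_scal, !PSeries_incr_1;
      auto using ex_pseries_plus, ex_pseries_scal, ex_pseries_incr_1, Rmult_comm.
    ring.
  + rewrite <- PSeries_scal; apply PSeries_ext; intros j.
    unfold h, g, PS_derive, PS_plus, PS_scal, PS_incr_1.
    assert (HS : forall i, INR (S i) <> 0) by (intros i; apply not_0_INR; lia).
    assert (Hf : forall i, f (S i) = (eps * e i - INR i * INR (S i) * f i)
           / (2 * INR (S i) ^ 2)) by reflexivity.
    destruct j as [|[|j]]; R_eq.
    * rewrite !Hf; simpl INR; field.
    * rewrite (Hf 1%nat), (Hf O); simpl INR; field.
    * rewrite (Hf (S (S j))); generalize (HS (S (S j))) (HS (S j)).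
      rewrite !S_INR; intros; field; trivial.
Qed.

(** * Existence of u_lambda *)

Lemma open_Rabs_lt (a r : R) : open (fun z => Rabs (z - a) < r).
Proof.
intros x Hx.
assert (He : 0 < r - Rabs (x - a)) by lra.
exists (mkposreal _ He); intros y Hy.
change (Rabs (y - x) < r - Rabs (x - a)) in Hy.
replace (y - a) with ((y - x) + (x - a)) by ring.
apply Rle_lt_trans with (1 := Rabs_triang _ _); lra.
Qed.

Lemma is_derive_cosh (x : R) : is_derive cosh x (sinh x).
Proof. apply is_derive_Reals, derivable_pt_lim_cosh. Qed.

Lemma continuous_cosh (x : R) : continuous cosh x.
Proof.
apply (ex_derive_continuous (V := R_NormedModule)); eexists; apply is_derive_cosh.
Qed.

Lemma sinh_pos (x : R) : 0 < x -> 0 < sinh x.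
Proof.
intros Hx; unfold sinh; assert (exp (- x) < exp x) by (apply exp_increasing; lra).
lra.
Qed.

Lemma sinh_sqr (x : R) : sinh x ^ 2 = cosh x ^ 2 - 1.
Proof.
assert (H : exp x * exp (- x) = 1) by (rewrite <- exp_plus, Rplus_opp_r; apply exp_0).
unfold sinh, cosh; nra.
Qed.

Lemma locally_scal_cosh (d a r x : R) : Rabs (d * cosh x - a) < r ->
  locally x (fun y => Rabs (d * cosh y - a) < r).
Proof.
intros Hx.
apply (continuous_scal_r d cosh x (continuous_cosh x)
         (fun z => Rabs (z - a) < r)).
now apply open_Rabs_lt.
Qed.

(* The substitution z = d cosh eta turns Delta_H into d/dz (z^2 - d^2) d/dz. *)
Lemma is_DeltaH_scal_cosh (d a r : R) (w dw l : R -> R) (eta : R) :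
  (forall z, Rabs (z - a) < r -> is_derive w z (dw z)) ->
  (forall z, Rabs (z - a) < r ->
     is_derive (fun y => (y ^ 2 - d ^ 2) * dw y) z (l z)) ->
  d <> 0 -> 0 < eta -> Rabs (d * cosh eta - a) < r ->
  is_DeltaH (V := R_NormedModule) (fun x => w (d * cosh x)) eta
    (l (d * cosh eta)).
Proof.
intros Hw Hdw Hd Heta Hr.
assert (Hz : forall x, is_derive (fun y => d * cosh y) x (d * sinh x))
  by (intros x; apply (is_derive_scal cosh x d), is_derive_cosh).
exists (fun x => d * sinh x * dw (d * cosh x)), (sinh eta * l (d * cosh eta)).
split; [|split].
- apply (filter_imp (fun y => Rabs (d * cosh y - a) < r)).
  + intros x Hx; apply (is_derive_comp w (fun y => d * cosh y)); auto.
  + now apply locally_scal_cosh.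
- apply (is_derive_ext (fun x =>
    / d * (((d * cosh x) ^ 2 - d ^ 2) * dw (d * cosh x)))).
  + intros x; R_eq.
    replace ((d * cosh x) ^ 2 - d ^ 2) with (d ^ 2 * sinh x ^ 2)
      by (rewrite sinh_sqr; ring).
    field; trivial.
  + evar_last.
    * apply is_derive_scal.
      apply (is_derive_comp (fun z => (z ^ 2 - d ^ 2) * dw z)
               (fun y => d * cosh y)); auto.
    * R_eq; field; trivial.
- R_eq; field; apply Rgt_not_eq, sinh_pos, Heta.
Qed.

Lemma taylor_family_Derive_n (D : R -> Prop) (u : R -> R) :
  (forall k x, D x -> ex_derive_n u k x) ->
  taylor_family D (fun k x => / INR (fact k) * Derive_n u k x).
Proof.
intros Hu k x Hx.
evar_last.
- apply is_derive_scal, Derive_correct, (Hu (S k) x Hx).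
- R_eq; change (Derive (Derive_n u k) x) with (Derive_n u (S k) x).
  rewrite fact_simpl, mult_INR; field.
  split; [apply INR_fact_neq_0|apply not_0_INR; lia].
Qed.

(** Passes from [Derive_n] to Taylor families: the first coefficient of the family of u^n is its
    derivative, hence agrees with [dw] on the disc. *)
Lemma ode_taylor_Q (n : nat) (lambda d a r : R) (u dw : R -> R) :
  (1 < n)%nat -> d <> 0 ->
  (forall k z, Rabs (z - a) < r -> ex_derive_n u k z) ->
  (forall z, Rabs (z - a) < r -> is_derive (fun y => u y ^ n) z (dw z)) ->
  (forall z, Rabs (z - a) < r ->
     is_derive (fun y => (y ^ 2 - d ^ 2) * dw y) z (lambda * u z)) ->
  Rabs (0 - a) < r -> u 0 <> 0 ->
  forall j, / INR (fact j) * Derive_n u j 0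
            = Q n j (u 0) (Derive_n u 1 0) lambda d.
Proof.
intros Hn Hd Hu Hw Hode Ha Hne.
set (D := fun z => Rabs (z - a) < r).
set (F := fun k x => / INR (fact k) * Derive_n u k x).
assert (HD : open D) by apply open_Rabs_lt.
assert (HF : taylor_family D F) by (now apply taylor_family_Derive_n).
assert (HF0 : forall x, F O x = u x) by (intros x; unfold F; simpl; field).
destruct (taylor_family_pow D F n HF) as [G [HG HG0]].
assert (HG1 : forall z, D z -> G 1%nat z = dw z).
{ intros z Hz.
  rewrite <- (is_derive_unique _ _ _ (Hw z Hz)).
  rewrite (Derive_ext _ (G O)) by (intros y; now rewrite HG0, HF0).
  rewrite (is_derive_unique _ _ _ (HG O z Hz)); simpl; ring. }
intros j.
replace (u 0) with (F O 0) by apply HF0.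
replace (Derive_n u 1 0) with (F 1%nat 0) by (unfold F; simpl; field).
apply (Q_taylor_family D F G); trivial; [|now rewrite HF0].
intros y Hy; rewrite HF0.
apply (is_derive_ext_loc (fun z => (z ^ 2 - d ^ 2) * dw z)); [|now apply Hode].
apply (filter_imp D); [|now apply HD].
intros z Hz; now rewrite HG1.
Qed.

Lemma admissible_exists (n : nat) (lambda : R) : (1 < n)%nat ->
  exists (d a r z0 : R) (u : R -> R), admissible n lambda d a r z0 u.
Proof.
intros Hn.
assert (HK : exists K, 0 < K /\ Rabs (lambda / K ^ (n - 1)) <= 1 / 32).
(* Since K >= 1 and n - 1 >= 1, K^(n-1) >= K >= 32 |lambda|. *)
{ exists (1 + 32 * Rabs lambda); assert (Hl := Rabs_pos lambda); split; [lra|].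
  assert (H1 : 1 + 32 * Rabs lambda <= (1 + 32 * Rabs lambda) ^ (n - 1)).
  { rewrite <- (pow_1 (1 + 32 * Rabs lambda)) at 1; apply Rle_pow; [lra|lia]. }
  set (P := _ ^ _) in *.
  unfold Rdiv at 1; rewrite Rabs_mult, Rabs_inv, (Rabs_pos_eq P) by lra.
  apply (Rmult_le_reg_r P); [lra|].
  rewrite Rmult_assoc, Rinv_l by lra; lra. }
destruct HK as [K [HK Heps]]; set (eps := lambda / K ^ (n - 1)) in *.
set (e := u_coef n eps); set (f := w_coef eps e).
set (c := PS_scal K e).
assert (He : forall y, Rabs y < 5 / 4 -> Rbar_lt (Rabs y) (CV_radius e)).
{ intros y Hy; apply CV_radius_weight; [|lra]; intros k; apply coef_bound; trivial; lia. }
assert (Hc : forall y, Rabs y < 5 / 4 -> Rbar_lt (Rabs y) (CV_radius c)).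
{ intros y Hy; unfold c; rewrite CV_radius_scal by lra; auto. }
assert (Hfw : forall k, (0 < k)%nat -> Rabs (f k) <= weight k / 8).
{ intros k Hk; apply coef_bound; trivial; lia. }
assert (Hf : forall y, Rabs y < 5 / 4 -> Rbar_lt (Rabs y) (CV_radius f)).
{ intros y Hy; apply CV_radius_weight; [|lra].
  intros [|k].
  - change (f O) with 1; rewrite Rabs_R1; unfold weight, inv_sq; simpl; lra.
  - assert (H := Hfw (S k) ltac:(lia)); assert (H' := weight_pos (S k)); lra. }
set (u := fun z => PSeries c (z + - 1)).
assert (Hux : forall k z, Rabs (z - 1) < 5 / 4 -> ex_derive_n u k z)
  by (intros k z Hz; apply ex_derive_n_comp_trans, ex_derive_n_PSeries, Hc, Hz).
assert (Hu : forall z, u z = K * PSeries e (z - 1))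
  by (intros z; apply PSeries_scal).
set (w := fun z => K ^ n * PSeries f (z - 1)).
set (dw := fun z => K ^ n * PSeries (PS_derive f) (z - 1)).
assert (Huw : forall z, Rabs (z - 1) < 5 / 4 -> u z ^ n = w z).
{ intros z Hz; rewrite Hu, Rpow_mult_distr; unfold w; f_equal.
  apply PSeries_w_coef; trivial; lia. }
(* A zero of u would be a zero of u^n = w, which is positive on the disc. *)
assert (Hne : forall z, Rabs (z - 1) < 5 / 4 -> u z <> 0).
{ intros z Hz H; assert (Hz' := Huw z Hz).
  rewrite H, pow_i in Hz' by lia; revert Hz'; apply Rlt_not_eq.
  apply Rmult_lt_0_compat; [now apply pow_lt|].
  apply PSeries_pos; trivial; lra. }
assert (Hw : forall z, Rabs (z - 1) < 5 / 4 -> is_derive w z (dw z)).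
{ intros z Hz; apply is_derive_scal.
  evar_last.
  - apply (is_derive_comp (PSeries f) (fun y => y - 1) z).
    + apply is_derive_PSeries, Hf, Hz.
    + instantiate (1 := 1); auto_derive; trivial; ring.
  - R_eq; ring. }
assert (Hode : forall z, Rabs (z - 1) < 5 / 4 ->
  is_derive (fun y => (y ^ 2 - 1 ^ 2) * dw y) z (lambda * u z)).
{ intros z Hz.
  apply (is_derive_ext (fun y => K ^ n * (((y - 1) ^ 2 + 2 * (y - 1))
                                  * PSeries (PS_derive f) (y - 1)))).
  { intros y; unfold dw; R_eq; ring. }
  evar_last.
  - apply is_derive_scal.
    apply (is_derive_comp (fun y => (y ^ 2 + 2 * y) * PSeries (PS_derive f) y)
      (fun y => y - 1) z).
    + apply w_coef_ode, Hf, Hz.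
    + instantiate (1 := 1); auto_derive; trivial; ring.
  - R_eq; rewrite Hu; unfold eps.
    (* The scaling undone: K^n eps = lambda K, and u is K times the sum of [e]. *)
    replace (K ^ n) with (K * K ^ (n - 1)) by (rewrite tech_pow_Rmult; f_equal; lia).
    field; apply pow_nonzero; lra. }
exists 1, 1, (5 / 4), 0, u.
split; [lra|split; [lra|split; [|split; [|split; [|split]]]]].
- split; [lra|split].
  + intros k; apply Hux; rewrite Rminus_diag, Rabs_R0; lra.
  + intros z Hz.
    apply (is_series_ext (fun j => c j * (z - 1) ^ j)).
    * intros j; unfold u; rewrite Derive_n_comp_trans.
      replace (1 + - 1) with 0 by ring; rewrite Derive_n_coef.
      -- R_eq; field; apply INR_fact_neq_0.
      -- rewrite <- Rabs_R0; apply Hc; rewrite Rabs_R0; lra.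
    * apply is_pseries_R, PSeries_correct, CV_radius_inside, Hc, Hz.
- split.
  (* Here cosh(ln 2) = 5/4, a point z > 1 well inside the disc. *)
  + exists (ln 2).
    assert (H : cosh (ln 2) = 5 / 4).
    { unfold cosh; rewrite exp_Ropp, exp_ln by lra; field. }
    assert (Hr : Rabs (1 * cosh (ln 2) - 1) < 5 / 4)
      by (rewrite H; apply Rabs_def1; lra).
    split; [rewrite <- ln_1; apply ln_increasing; lra|auto].
  + intros eta Heta Hr.
    apply (is_DeltaH_scal_cosh 1 1 (5 / 4) (fun z => u z ^ n) dw
             (fun z => lambda * u z)); trivial.
    intros z Hz; apply (is_derive_ext_loc w); [|now apply Hw].
    apply (filter_imp (fun y => Rabs (y - 1) < 5 / 4)).
    * intros y Hy; symmetry; now apply Huw.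
    * now apply open_Rabs_lt.
- apply Rabs_def1; lra.
- apply Hne, Rabs_def1; lra.
- intros k _.
  apply (ode_taylor_Q n lambda 1 1 (5 / 4) u dw); trivial; try lra.
  + intros z Hz; apply (is_derive_ext_loc w); [|now apply Hw].
    apply (filter_imp (fun y => Rabs (y - 1) < 5 / 4)).
    * intros y Hy; symmetry; now apply Huw.
    * now apply open_Rabs_lt.
  + apply Rabs_def1; lra.
  + apply Hne, Rabs_def1; lra.
Qed.

(** * Complex exponential and logarithm *)

Ltac C_eq :=
  repeat match goal with
  | |- context [@plus ?G ?x ?y] => change (@plus G x y) with (Cplus x y)
  end;
  match goal with |- @eq _ ?x ?y => cut (@eq C x y); [exact (fun H => H)|] end.

(** The projections are linear, which gives one direction; the other writes f as Re f times 1 plus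
    Im f times i. *)
Lemma is_derive_C (f : R -> C) (t : R) (l : C) :
  is_derive (V := C_R_NormedModule) f t l <->
  is_derive (fun s => Re (f s)) t (Re l) /\ is_derive (fun s => Im (f s)) t (Im l).
Proof.
split.
- intros Hf; split.
  + apply (filterdiff_ext_lin _ (fun y : R => fst (scal y (l : C_R_NormedModule))));
      [|reflexivity].
    apply (filterdiff_comp' f (fun z : C_R_NormedModule => fst z) t); [exact Hf|].
    apply filterdiff_linear, is_linear_fst.
  + apply (filterdiff_ext_lin _ (fun y : R => snd (scal y (l : C_R_NormedModule))));
      [|reflexivity].
    apply (filterdiff_comp' f (fun z : C_R_NormedModule => snd z) t); [exact Hf|].
    apply filterdiff_linear, is_linear_snd.
- intros [H1 H2].
  apply (is_derive_ext (V := C_R_NormedModule) (fun s =>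
    plus (scal (Re (f s)) (RtoC 1 : C_R_NormedModule))
         (scal (Im (f s)) (Ci : C_R_NormedModule)))).
  { intros s; rewrite !scal_R_Cmult.
    apply injective_projections; simpl; unfold Re, Im; R_eq; ring. }
  evar_last.
  + apply (is_derive_plus (V := C_R_NormedModule)).
    * apply (is_derive_scal_l (V := C_R_NormedModule)), H1.
    * apply (is_derive_scal_l (V := C_R_NormedModule)), H2.
  + rewrite !scal_R_Cmult; apply injective_projections; simpl; unfold Re, Im; R_eq; ring.
Qed.

Lemma is_derive_Rmult (f g : R -> R) (t df dg : R) :
  is_derive f t df -> is_derive g t dg ->
  is_derive (fun s => f s * g s) t (df * g t + f t * dg).
Proof. intros Hf Hg; exact (is_derive_mult f g t df dg Hf Hg Rmult_comm). Qed.

Lemma is_derive_Cmult (f g : R -> C) (t : R) (df dg : C) :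
  is_derive (V := C_R_NormedModule) f t df ->
  is_derive (V := C_R_NormedModule) g t dg ->
  is_derive (V := C_R_NormedModule) (fun s => (f s * g s)%C) t
    (df * g t + f t * dg)%C.
Proof.
intros Hf Hg; apply is_derive_C in Hf, Hg; apply is_derive_C.
destruct Hf as [Hf1 Hf2]; destruct Hg as [Hg1 Hg2]; split.
- evar_last.
  + apply (is_derive_minus (V := R_NormedModule)
      (fun s => Re (f s) * Re (g s)) (fun s => Im (f s) * Im (g s)));
      apply is_derive_Rmult; eauto.
  + R_eq; unfold Re, Im; simpl; ring.
- evar_last.
  + apply (is_derive_plus (V := R_NormedModule)
      (fun s => Re (f s) * Im (g s)) (fun s => Im (f s) * Re (g s)));
      apply is_derive_Rmult; eauto.
  + R_eq; unfold Re, Im; simpl; ring.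
Qed.

Lemma is_derive_RtoC (f : R -> R) (t l : R) :
  is_derive f t l -> is_derive (V := C_R_NormedModule) (fun s => RtoC (f s)) t (RtoC l).
Proof.
intros Hf; apply is_derive_C; split; [exact Hf|].
exact (is_derive_const (V := R_NormedModule) 0 t).
Qed.

Lemma is_derive_Cconst (z : C) (t : R) :
  is_derive (V := C_R_NormedModule) (fun _ => z) t (RtoC 0).
Proof. apply (is_derive_const (V := C_R_NormedModule)). Qed.

Lemma is_derive_Cscal (z : C) (f : R -> C) (t : R) (l : C) :
  is_derive (V := C_R_NormedModule) f t l ->
  is_derive (V := C_R_NormedModule) (fun s => (z * f s)%C) t (z * l)%C.
Proof.
intros Hf; evar_last.
- apply is_derive_Cmult; [apply is_derive_Cconst|exact Hf].
- simpl; ring.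
Qed.

Lemma is_derive_Cexp (f : R -> C) (t : R) (l : C) :
  is_derive (V := C_R_NormedModule) f t l ->
  is_derive (V := C_R_NormedModule) (fun s => Cexp (f s)) t (l * Cexp (f t))%C.
Proof.
intros Hf; apply is_derive_C in Hf; destruct Hf as [H1 H2].
apply is_derive_C; unfold Cexp; simpl.
split.
- apply (is_derive_ext (fun s => exp (Re (f s)) * cos (Im (f s)))); [reflexivity|].
  evar_last.
  + apply (is_derive_Rmult (fun s => exp (Re (f s))) (fun s => cos (Im (f s)))).
    * apply (is_derive_comp exp); [apply is_derive_exp|exact H1].
    * apply (is_derive_comp cos); [apply is_derive_cos|exact H2].
  + R_eq; unfold Re, Im; ring.
- apply (is_derive_ext (fun s => exp (Re (f s)) * sin (Im (f s)))); [reflexivity|].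
  evar_last.
  + apply (is_derive_Rmult (fun s => exp (Re (f s))) (fun s => sin (Im (f s)))).
    * apply (is_derive_comp exp); [apply is_derive_exp|exact H1].
    * apply (is_derive_comp sin); [apply is_derive_sin|exact H2].
  + R_eq; unfold Re, Im; ring.
Qed.

Lemma Cexp_plus (z w : C) : Cexp (z + w) = (Cexp z * Cexp w)%C.
Proof.
unfold Cexp, Re, Im; apply injective_projections; simpl;
  rewrite exp_plus, ?cos_plus, ?sin_plus; ring.
Qed.

Lemma Cexp_pow (z : C) (k : nat) : (Cexp z ^ k)%C = Cexp (RtoC (INR k) * z).
Proof.
induction k as [|k IH].
- unfold Cexp, Re, Im; apply injective_projections; simpl;
  rewrite !Rmult_0_l, ?Rminus_0_r, ?Rplus_0_r, exp_0, ?cos_0, ?sin_0; ring.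
- rewrite S_INR, RtoC_plus, Cpow_S, IH, <- Cexp_plus; f_equal; ring.
Qed.

(** The principal logarithm on the half plane Re z > 0 only, where the arctangent of Im z / Re z is
    the argument. *)
Definition Clog (z : C) : C :=
  (/ 2 * ln (Re z ^ 2 + Im z ^ 2), atan (Im z / Re z)).

Lemma Cexp_Clog (z : C) : 0 < Re z -> Cexp (Clog z) = z.
Proof.
destruct z as [x y]; unfold Clog, Cexp, Re, Im; cbn [fst snd]; intros Hx.
assert (Hs : 0 < x ^ 2 + y ^ 2) by nra.
assert (He : exp (/ 2 * ln (x ^ 2 + y ^ 2)) = sqrt (x ^ 2 + y ^ 2)).
{ rewrite <- Rpower_sqrt by trivial; reflexivity. }
assert (Hq : sqrt (1 + (y / x)²) = sqrt (x ^ 2 + y ^ 2) / x).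
{ replace (1 + (y / x)²) with ((x ^ 2 + y ^ 2) / x ^ 2) by (unfold Rsqr; field; lra).
  rewrite sqrt_div by nra; rewrite sqrt_pow2 by lra; reflexivity. }
assert (H0 := sqrt_lt_R0 _ Hs).
rewrite He, cos_atan, sin_atan, Hq; f_equal; field; lra.
Qed.

Lemma is_derive_Clog (f : R -> C) (t : R) (l : C) : 0 < Re (f t) ->
  is_derive (V := C_R_NormedModule) f t l ->
  is_derive (V := C_R_NormedModule) (fun s => Clog (f s)) t (l / f t)%C.
Proof.
intros Hp Hf; apply is_derive_C in Hf; destruct Hf as [H1 H2].
assert (Hs : 0 < Re (f t) ^ 2 + Im (f t) ^ 2) by nra.
apply is_derive_C; unfold Clog; simpl; split.
- apply (is_derive_ext (fun s => / 2 * ln (Re (f s) ^ 2 + Im (f s) ^ 2)));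
    [reflexivity|].
  evar_last.
  + apply is_derive_scal, (is_derive_comp ln).
    * apply is_derive_ln, Hs.
    * apply (is_derive_plus (V := R_NormedModule)); apply is_derive_pow; eauto.
  + R_eq; simpl in *; unfold Re, Im in *; simpl; field; lra.
- apply (is_derive_ext (fun s => atan (Im (f s) / Re (f s)))); [reflexivity|].
  evar_last.
  + apply (is_derive_comp atan).
    * apply is_derive_atan.
    * apply is_derive_div; [exact H2|exact H1|lra].
  + R_eq; simpl in *; unfold Re, Im, Rsqr in *; simpl; field; lra.
Qed.

Lemma Cexp_surj (z : C) : z <> RtoC 0 -> exists l, Cexp l = z.
Proof.
intros Hz.
set (i2 := (0, PI / 2) : C).
assert (Hi : Cexp i2 = Ci).
{ unfold Cexp, Re, Im; simpl; rewrite exp_0, cos_PI2, sin_PI2, !Rmult_1_l; reflexivity. }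
(* Quarter turns bring any nonzero number into the half plane of [Clog]; one turn is undone by three
   more, as i^4 = 1. *)
assert (Hrot : forall w, (exists l, Cexp l = (Ci * w)%C) -> exists l, Cexp l = w).
{ intros w [l Hl]; exists (l + (i2 + (i2 + i2)))%C.
  rewrite !Cexp_plus, Hl, Hi.
  replace (Ci * w * (Ci * (Ci * Ci)))%C with ((Ci * Ci) * (Ci * Ci) * w)%C by ring.
  apply injective_projections; simpl; ring. }
destruct z as [x y].
destruct (Rtotal_order 0 x) as [H|[H|H]].
- eexists; apply Cexp_Clog; exact H.
- destruct (Rtotal_order 0 y) as [H'|[H'|H']].
  + apply Hrot, Hrot, Hrot; eexists; apply Cexp_Clog; simpl; lra.
  + now destruct Hz; subst.
  + apply Hrot; eexists; apply Cexp_Clog; simpl; lra.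
- apply Hrot, Hrot; eexists; apply Cexp_Clog; simpl; lra.
Qed.

Lemma Cpow_root_exists (z : C) (k : nat) : (0 < k)%nat -> z <> RtoC 0 ->
  exists w, (w ^ k)%C = z.
Proof.
intros Hk Hz; destruct (Cexp_surj z Hz) as [l <-].
exists (Cexp (l / RtoC (INR k))).
rewrite Cexp_pow; f_equal; field.
intros H; apply RtoC_inj in H; revert H; apply not_0_INR; lia.
Qed.

(** * Local solutions *)

Lemma locally_interval (P : R -> Prop) (x : R) : locally x P ->
  exists e, 0 < e /\ forall y, x - e < y < x + e -> P y.
Proof.
intros [e He]; exists e; split; [apply cond_pos|].
intros y Hy; apply He; change (Rabs (y - x) < e); apply Rabs_def1; lra.
Qed.

Lemma continuous_locally_pos (f : R -> R) (x : R) :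
  ex_derive f x -> 0 < f x -> locally x (fun y => 0 < f y).
Proof.
intros Hf Hx; apply (ex_derive_continuous (V := R_NormedModule)) in Hf.
apply Hf, (open_gt 0), Hx.
Qed.

(** The time factor is a constant for Delta_H; a vector v as factor serves the real and the complex
    equation alike. *)
Lemma is_DeltaH_scal {V : NormedModule R_AbsRing} (f : R -> R) (eta l : R) (v : V) :
  is_DeltaH (V := R_NormedModule) f eta l ->
  is_DeltaH (fun x => scal (f x) v) eta (scal l v).
Proof.
intros [df [d [Hf [Hdf ->]]]].
exists (fun x => scal (df x) v), (scal d v); split; [|split].
- apply (filter_imp (fun x => is_derive f x (df x))); [|exact Hf].
  intros x Hx; exact (is_derive_scal_l f x (df x) v Hx).
- apply (is_derive_ext (fun x => scal (scal (sinh x) (df x)) v)).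
  + intros x; symmetry; apply (scal_assoc (sinh x) (df x) v).
  + exact (is_derive_scal_l (fun x => scal (sinh x) (df x)) eta d v Hdf).
- symmetry; apply (scal_assoc (/ sinh eta) d v).
Qed.

Lemma is_DeltaH_ext_loc {V : NormedModule R_AbsRing} (f g : R -> V) (eta : R) (l : V) :
  locally eta (fun x => f x = g x) -> is_DeltaH f eta l -> is_DeltaH g eta l.
Proof.
intros Hfg [df [d [Hf Hd]]]; exists df, d; split; [|exact Hd].
apply locally_locally in Hfg.
apply (filter_imp (fun x => locally x (fun y => f y = g y) /\ is_derive f x (df x))).
- intros x [H1 H2]; now apply (is_derive_ext_loc f).
- now apply filter_and.
Qed.

(* T' = lambda T^n - T is the equation left once the eigenfunction is factored out. *)
Lemma temporal_I (n : nat) (lambda c t0 tau : R) : (1 < n)%nat ->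
  denom_I n lambda c t0 <> 0 -> tau ^ (n - 1) = / denom_I n lambda c t0 ->
  exists (t1 t2 : R) (T : R -> R), t1 < t0 < t2 /\ T t0 = tau /\
    forall t, t1 < t < t2 -> denom_I n lambda c t <> 0 /\
      T t ^ (n - 1) = / denom_I n lambda c t /\
      is_derive T t (lambda * T t ^ n - T t).
Proof.
intros Hn H0 Htau; set (D := denom_I n lambda c) in *.
assert (Hk : INR (n - 1) = INR n - 1) by (rewrite minus_INR by lia; reflexivity).
assert (Hk0 : INR n - 1 <> 0) by (rewrite <- Hk; apply not_0_INR; lia).
assert (HD : forall t, is_derive (fun s => D s / D t0) t
                         ((INR n - 1) * (D t - lambda) / D t0)).
{ intros t; unfold D at 1 3, denom_I; auto_derive; trivial.
  unfold denom_I; field; exact H0. }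
destruct (locally_interval (fun t => 0 < D t / D t0) t0) as [h [Hh Hq]].
{ apply continuous_locally_pos; [eexists; apply HD|].
  unfold Rdiv; rewrite Rinv_r by trivial; lra. }
(* This is tau (D(t)/D(t0))^(-1/(n-1)): the quotient is positive near t0, so the prescribed root
   [tau] is continued whatever its sign. *)
exists (t0 - h), (t0 + h), (fun t => tau * exp (- / (INR n - 1) * ln (D t / D t0))).
split; [lra|split].
{ unfold Rdiv; rewrite Rinv_r, ln_1, Rmult_0_r, exp_0 by trivial; ring. }
intros t Ht; specialize (Hq t Ht).
assert (Ht0 : D t <> 0).
{ intros H; rewrite H in Hq; unfold Rdiv in Hq; rewrite Rmult_0_l in Hq; lra. }
assert (Hpow : (tau * exp (- / (INR n - 1) * ln (D t / D t0))) ^ (n - 1) = / D t).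
{ rewrite Rpow_mult_distr, Htau, <- Rpower_pow by apply exp_pos.
  unfold Rpower; rewrite ln_exp, Hk.
  replace ((INR n - 1) * (- / (INR n - 1) * ln (D t / D t0)))
    with (- ln (D t / D t0)) by (field; trivial).
  rewrite exp_Ropp, exp_ln by trivial; field; auto. }
split; [exact Ht0|split; [exact Hpow|]].
evar_last.
- apply is_derive_scal, (is_derive_comp exp); [apply is_derive_exp|].
  apply is_derive_scal, (is_derive_comp ln); [apply is_derive_ln, Hq|apply HD].
- R_eq; set (x := exp _) in *.
  (* With D' = (n-1)(D - lambda) one has T' = -T (D - lambda)/D, and T^n = T/D. *)
  replace ((tau * x) ^ n) with (tau * x * (tau * x) ^ (n - 1))
    by (rewrite tech_pow_Rmult; f_equal; lia).
  rewrite Hpow; field; auto.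
Qed.

(** Here D' = (n-1) kappa (lambda - D), so T = tau exp(-Log(D/D(t0))/(n-1)) has T' = -kappa T
    (lambda - D)/D. As T^(n-1) = -kappa/D, this is lambda T^n + kappa T. *)
Lemma temporal_II (n : nat) (omega alpha lambda c t0 : R) (tau : C)
  (kap := kappa omega alpha) (D := denom_II n omega alpha lambda c) : (1 < n)%nat ->
  D t0 <> RtoC 0 -> (tau ^ (n - 1))%C = (- kap / D t0)%C ->
  exists (t1 t2 : R) (T : R -> C), t1 < t0 < t2 /\ T t0 = tau /\
    forall t, t1 < t < t2 -> D t <> RtoC 0 /\
      (T t ^ (n - 1))%C = (- kap / D t)%C /\
      is_derive (V := C_R_NormedModule) T t (RtoC lambda * T t ^ n + kap * T t)%C.
Proof.
intros Hn H0 Htau.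
assert (Hk : INR (n - 1) = INR n - 1) by (rewrite minus_INR by lia; reflexivity).
assert (Hk0 : RtoC (INR n - 1) <> RtoC 0).
{ intros H; apply RtoC_inj in H; revert H; rewrite <- Hk; apply not_0_INR; lia. }
assert (HD : forall t, is_derive (V := C_R_NormedModule) (fun s => / D t0 * D s)%C t
               (/ D t0 * (RtoC (INR n - 1) * kap * (RtoC lambda - D t)))%C).
{ intros t; apply is_derive_Cscal.
  apply (is_derive_ext (V := C_R_NormedModule) (fun s => plus
    (RtoC lambda : C_R_NormedModule)
    (- RtoC c * Cexp (- (RtoC (INR n - 1) * kap) * RtoC s))%C)).
  { intros s; unfold D, denom_II; fold kap; C_eq.
    replace (- (RtoC (INR n - 1) * kap) * RtoC s)%C
      with (- (RtoC (INR n - 1) * kap * RtoC s))%C by ring.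
    ring. }
  evar_last.
  - apply (is_derive_plus (V := C_R_NormedModule)).
    + apply is_derive_Cconst.
    + apply is_derive_Cscal, is_derive_Cexp, is_derive_Cscal, is_derive_RtoC, is_derive_id.
  - unfold D, denom_II; fold kap; C_eq.
    replace (- (RtoC (INR n - 1) * kap) * RtoC t)%C
      with (- (RtoC (INR n - 1) * kap * RtoC t))%C by ring.
    change (RtoC one) with (RtoC 1); ring. }
(* The quotient D/D(t0) equals 1 at t0, so it stays near t0 in the half plane where [Clog] inverts
   [Cexp]. *)
destruct (locally_interval (fun t => 0 < Re (/ D t0 * D t)%C) t0) as [h [Hh Hq]].
{ apply continuous_locally_pos.
  - eexists; apply (proj1 (is_derive_C _ _ _) (HD t0)).
  - rewrite Cinv_l by trivial; simpl; lra. }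
exists (t0 - h), (t0 + h),
  (fun t => tau * Cexp (- / RtoC (INR n - 1) * Clog (/ D t0 * D t)))%C.
split; [lra|split].
{ rewrite Cinv_l by trivial.
  replace (Clog (RtoC 1)) with (RtoC 0).
  - rewrite Cmult_0_r; replace (Cexp (RtoC 0)) with (RtoC 1); [ring|].
    unfold Cexp; simpl; rewrite exp_0, cos_0, sin_0; apply injective_projections; simpl; ring.
  - unfold Clog, RtoC, Re, Im; cbn [fst snd].
    replace (1 ^ 2 + 0 ^ 2) with 1 by ring; unfold Rdiv.
    rewrite ln_1, Rmult_0_l, Rmult_0_r, atan_0; reflexivity. }
intros t Ht; specialize (Hq t Ht).
assert (Ht0 : D t <> RtoC 0).
{ intros H; rewrite H, Cmult_0_r in Hq; simpl in Hq; lra. }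
set (L := (- / RtoC (INR n - 1) * Clog (/ D t0 * D t))%C).
assert (Hpow : ((tau * Cexp L) ^ (n - 1))%C = (- kap / D t)%C).
{ rewrite Cpow_mult_l, Htau, Cexp_pow, Hk.
  assert (HL : (Cexp (RtoC (INR n - 1) * L) * (/ D t0 * D t))%C = RtoC 1).
  { rewrite <- (Cexp_Clog (/ D t0 * D t)) at 1 by exact Hq.
    rewrite <- Cexp_plus; unfold L.
    match goal with |- Cexp ?z = _ => replace z with (RtoC 0) by (field; trivial) end.
    unfold Cexp; simpl; rewrite exp_0, cos_0, sin_0.
    apply injective_projections; simpl; ring. }
  transitivity (- kap / D t * (Cexp (RtoC (INR n - 1) * L) * (/ D t0 * D t)))%C.
  - field; auto.
  - rewrite HL; ring. }
split; [exact Ht0|split; [exact Hpow|]].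
evar_last.
- apply is_derive_Cscal, is_derive_Cexp, is_derive_Cscal, is_derive_Clog; [exact Hq|apply HD].
- fold L; set (Tn := (tau * Cexp L)%C) in *.
  replace (Tn ^ n)%C with (Tn * Tn ^ (n - 1))%C
    by (rewrite <- Cpow_S; f_equal; lia).
  rewrite Hpow; unfold Tn; C_eq; unfold L; field; auto.
Qed.

Lemma admissible_spatial (n : nat) (lambda d a r z0 : R) (u : R -> R) (eta0 : R) :
  admissible n lambda d a r z0 u -> 0 < eta0 -> Rabs (d * cosh eta0 - a) < r ->
  exists eta1 eta2, 0 <= eta1 < eta0 /\ eta0 < eta2 /\
    forall eta, eta1 < eta < eta2 ->
      ex_series (taylor_term u d a eta) /\
      Series (taylor_term u d a eta) = u (d * cosh eta) /\
      is_DeltaH (V := R_NormedModule) (fun x => Series (taylor_term u d a x) ^ n) eta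
        (lambda * u (d * cosh eta)).
Proof.
intros [Hd [Ha [[Hr [_ Hu]] [[_ Heig] _]]]] Heta0 Hin.
destruct (locally_interval _ _ (locally_scal_cosh d a r eta0 Hin)) as [h [Hh Hloc]].
(* The maximum with 0 keeps eta positive, where the eigenvalue equation is available. *)
exists (Rmax 0 (eta0 - h)), (eta0 + h).
assert (Hs : forall eta, Rabs (d * cosh eta - a) < r ->
  is_series (taylor_term u d a eta) (u (d * cosh eta))) by (intros eta; apply Hu).
split; [split; [apply Rmax_l|apply Rmax_lub_lt; lra]|split; [lra|]].
intros eta [H1 H2]; apply Rmax_Rlt in H1.
assert (Hr' : Rabs (d * cosh eta - a) < r) by (apply Hloc; lra).
split; [eexists; now apply Hs|split; [now apply is_series_unique, Hs|]].
apply (is_DeltaH_ext_loc (V := R_NormedModule) (fun x => u (d * cosh x) ^ n));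
  [|now apply Heig].
apply (filter_imp (fun y => Rabs (d * cosh y - a) < r)); [|now apply locally_scal_cosh].
intros x Hx; now rewrite (is_series_unique _ _ (Hs x Hx)).
Qed.

Theorem corollary4p2 (n : nat) (omega alpha lambda : R)
  (hn : (1 < n)%nat) (homega : omega <> 0) (halpha : alpha <> 0)
  (hlambda : lambda <> 0) :
  (exists (d a r z0 : R) (u : R -> R), admissible n lambda d a r z0 u) /\
  (forall (d a r z0 : R) (u : R -> R), admissible n lambda d a r z0 u ->
   forall eta0 t0 : R, 0 < eta0 -> Rabs (d * cosh eta0 - a) < r ->
     (exists c tau : R,
        c <> 0 /\ denom_I n lambda c t0 <> 0 /\
        tau ^ (n - 1) = / denom_I n lambda c t0) /\
     (forall c tau : R,
        c <> 0 -> denom_I n lambda c t0 <> 0 ->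
        tau ^ (n - 1) = / denom_I n lambda c t0 ->
        local_solution_I n lambda c d a u eta0 t0 tau) /\
     (exists (c : R) (tau : C),
        c <> 0 /\ denom_II n omega alpha lambda c t0 <> RtoC 0 /\
        (tau ^ (n - 1))%C
        = (- kappa omega alpha / denom_II n omega alpha lambda c t0)%C) /\
     (forall (c : R) (tau : C),
        c <> 0 -> denom_II n omega alpha lambda c t0 <> RtoC 0 ->
        (tau ^ (n - 1))%C
        = (- kappa omega alpha / denom_II n omega alpha lambda c t0)%C ->
        local_solution_II n omega alpha lambda c d a u eta0 t0 tau)).
Proof.
split; [now apply admissible_exists|].
intros d a r z0 u Hadm eta0 t0 Heta0 Hin.
destruct (admissible_spatial n lambda d a r z0 u eta0 Hadm Heta0 Hin)
  as [eta1 [eta2 [He1 [He2 Hsp]]]].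
split; [|split; [|split]].
(* The constant c is chosen so that the denominator at t0 equals D = |lambda| + 1: being positive,
   its inverse has a real root for every n, and D > lambda makes c nonzero. *)
- set (E := exp ((INR n - 1) * t0)); assert (HE : 0 < E) by apply exp_pos.
  set (D := Rabs lambda + 1).
  assert (HD : lambda < D) by (unfold D; assert (H := Rle_abs lambda); lra).
  assert (HD0 : 0 < D) by (unfold D; assert (H := Rabs_pos lambda); lra).
  assert (HDE : denom_I n lambda ((lambda - D) / E) t0 = D)
    by (unfold denom_I; fold E; field; lra).
  exists ((lambda - D) / E), (Rpower (/ D) (/ INR (n - 1))).
  rewrite HDE; split; [|split; [lra|]].
  + intros H; apply (Rmult_eq_compat_r E) in H; unfold Rdiv in H.
    rewrite Rmult_assoc, Rinv_l, Rmult_0_l in H; lra.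
  + rewrite <- Rpower_pow by apply exp_pos; rewrite Rpower_mult, Rinv_l.
    * apply Rpower_1, Rinv_0_lt_compat, HD0.
    * apply not_0_INR; lia.
- intros c tau _ Hden Htau.
  destruct (temporal_I n lambda c t0 tau hn Hden Htau) as [t1 [t2 [T [Ht [HT0 HT]]]]].
  exists eta1, eta2, t1, t2, T.
  split; [tauto|split; [exact Ht|split; [exact HT0|split; [|split]]]].
  + intros t Ht'; destruct (HT t Ht') as [H1 [H2 H3]]; repeat split; trivial.
    eexists; exact H3.
  + intros eta Heta; apply Hsp, Heta.
  + intros U eta t Heta Ht'.
    destruct (Hsp eta Heta) as [_ [HS HH]]; destruct (HT t Ht') as [_ [_ H3]].
    (* With S the spatial factor, the time derivative is T' S and Delta_H U^n is lambda S T^n; their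
       difference is -T S. *)
    exists ((lambda * T t ^ n - T t) * Series (taylor_term u d a eta)),
           (lambda * u (d * cosh eta) * T t ^ n).
    split; [|split].
    * apply (is_derive_scal_l (V := R_NormedModule) T t _ _ H3).
    * apply (is_DeltaH_ext_loc (V := R_NormedModule)
        (fun x => scal (Series (taylor_term u d a x) ^ n) (T t ^ n))).
      -- apply filter_forall; intros x; unfold U; rewrite Rpow_mult_distr.
         apply Rmult_comm.
      -- apply (is_DeltaH_scal (V := R_NormedModule) _ _ _ _ HH).
    * unfold U; rewrite HS; ring.
- assert (Hkap : kappa omega alpha <> RtoC 0).
  { unfold kappa; intros H; apply (f_equal Im) in H; simpl in H.
    assert (omega / alpha <> 0)
      by (apply Rmult_integral_contrapositive_currified; trivial;
          now apply Rinv_neq_0_compat).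
    lra. }
  (* The exponent is purely imaginary, so with c = 2 lambda a vanishing denominator would make a
     number of modulus 1 equal to 1/2. *)
  assert (Hden : denom_II n omega alpha lambda (2 * lambda) t0 <> RtoC 0).
  { unfold denom_II; set (z := (- _)%C).
    assert (Hz : Re z = 0) by (unfold z, kappa; simpl; ring).
    clearbody z; unfold Cexp; rewrite Hz, exp_0; intros H.
    assert (H1 := f_equal Re H); assert (H2 := f_equal Im H); simpl in H1, H2.
    assert (Hs := sin2_cos2 (Im z)); unfold Rsqr in Hs.
    assert (Hc : cos (Im z) = 1 / 2).
    { apply (Rmult_eq_reg_l (2 * lambda)); lra. }
    assert (Hs0 : sin (Im z) = 0).
    { apply (Rmult_eq_reg_l (2 * lambda)); lra. }
    rewrite Hc, Hs0 in Hs; lra. }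
  destruct (Cpow_root_exists
    (- kappa omega alpha / denom_II n omega alpha lambda (2 * lambda) t0) (n - 1))
    as [tau Htau]; [lia| |].
  { intros H; apply Hkap.
    set (den := denom_II _ _ _ _ _ _) in *.
    transitivity (- (- kappa omega alpha / den) * den)%C; [field; trivial|].
    rewrite H; ring. }
  exists (2 * lambda), tau; repeat split; trivial; lra.
- intros c tau _ Hden Htau.
  destruct (temporal_II n omega alpha lambda c t0 tau hn Hden Htau)
    as [t1 [t2 [T [Ht [HT0 HT]]]]].
  exists eta1, eta2, t1, t2, T.
  split; [tauto|split; [exact Ht|split; [exact HT0|split; [|split]]]].
  + intros t Ht'; destruct (HT t Ht') as [H1 [H2 H3]]; repeat split; trivial.
    eexists; exact H3.
  + intros eta Heta; apply Hsp, Heta.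
  + intros U eta t Heta Ht'.
    destruct (Hsp eta Heta) as [_ [HS HH]]; destruct (HT t Ht') as [_ [_ H3]].
    set (S := Series (taylor_term u d a eta)) in *.
    exists ((RtoC lambda * T t ^ n + kappa omega alpha * T t) * RtoC S)%C,
           (Cmult (RtoC (lambda * u (d * cosh eta))) (Cpow (T t) n)).
    split; [|split].
    * evar_last.
      -- apply is_derive_Cmult; [exact H3|apply is_derive_Cconst].
      -- simpl; fold S; ring.
    * apply (is_DeltaH_ext_loc (V := C_R_NormedModule)
        (fun x => scal (Series (taylor_term u d a x) ^ n) (T t ^ n)%C)).
      -- apply filter_forall; intros x; unfold U; rewrite scal_R_Cmult.
         rewrite Cpow_mult_l, RtoC_pow; apply Cmult_comm.
      -- rewrite <- scal_R_Cmult; apply (is_DeltaH_scal (V := C_R_NormedModule) _ _ _ _ HH).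
    * unfold U; fold S; rewrite <- HS, RtoC_mult; ring.
Qed.
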